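(* Fix $a>1$, let $Y=(Y_t:t>0)$ be the STIT tessellation process on $\mathbb{R}^\ell$ driven by $\Lambda$, and set $\mathcal{Z}=(\mathcal{Z}_s:s\in\mathbb{R})$ with $\mathcal{Z}_s=a^sY_{a^s}$. Then $\mathcal{Z}$ is a stationary Markov process; that is, it is a Markov process and for all $t\in\mathbb{R}$ the equality in distribution $\mathcal{Z}\sim\sigma_{\mathbb{T}}^t\circ\mathcal{Z}$ holds. Hence $(\mathbb{T}^{\mathbb{R}},\widehat{\mathcal{B}}(\mathbb{T}^{\mathbb{R}}),\mu^{\mathcal{Z}},(\sigma_{\mathbb{T}}^t:t\in\mathbb{R}))$ is a shift flow.
   Context: Fix $\ell\ge 1$. A polytope is the convex hull of a finite point set in $\mathbb{R}^\ell$, always assumed to have nonempty interior. A tessellation of $\mathbb{R}^\ell$ is a countable, locally finite family of polytopes (cells) with pairwise disjoint interiors and union $\mathbb{R}^\ell$; $\mathbb{T}$ is the set of all tessellations. With $\mathbb{F}'$ the space of nonempty closed subsets of $\mathbb{R}^\ell$ with the Fell topology, and $\mathbb{F}(\mathbb{F}')$ the space of closed subsets of $\mathbb{F}'$ with the Fell topology (compact metrizable), $\mathbb{T}$ is a Borel subset of $\mathbb{F}(\mathbb{F}')$ and carries the trace Borel $\sigma$-field $\mathcal{B}(\mathbb{T})$. For $c\ne 0$, $cT=\{cC:C\in T\}$. A window $W$ is a polytope with nonempty interior; $\mathbb{T}_W$ is the set of (finite) tessellations of $W$ into polytopes with disjoint interiors, a Borel subset of $\mathbb{F}(\mathbb{F}'_W)$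 (closed subsets, with the Fell topology, of the space $\mathbb{F}'_W$ of nonempty closed subsets of $W$ with the Fell topology). For $T\in\mathbb{T}$, $T\wedge W=\{C\cap W:C\in T,\ \mathrm{int}(C\cap W)\ne\emptyset\}\in\mathbb{T}_W$. STIT process. Let $\Lambda$ be a nonzero $\sigma$-finite translation invariant measure on the space $\mathcal{H}$ of hyperplanes of $\mathbb{R}^\ell$ such that there is no line to which all hyperplanes of the support of $\Lambda$ are parallel. For a set $B\subseteq\mathbb{R}^\ell$ put $[B]=\{H\in\mathcal{H}:H\cap B\ne\emptyset\}$; one has $0<\Lambda([W])<\infty$ for every window $W$, and $\Lambda_W=\Lambda([W])^{-1}\Lambda(\cdot\cap[W])$. For a window $W$, $Y\wedge W=(Y_t\wedge W:t\ge 0)$ is the pure jump càdlàg Markov process in $\mathbb{T}_W$ starting from $Y_0\wedge W=\{W\}$ in which, independently, each present cell $C$ has an exponential lifetime with parameter $\Lambda([C])$, at the end of which $C$ is replaced by the two cells into which it is divided by a random hyperplane of law $\Lambda_C$ (independent of everything else). These laws are consistent: $(Y\wedge W')\wedge W\sim Y\wedge W$ for $W\subseteq W'$, where $\sim$ denotes equality of distributions. The STIT tessellation process $Y=(Y_t:t>0)$ is the $\mathbb{T}$-valued Markov process whose restriction to each window $W$ has this law. $\widehat{\mathcal{B}}(\mathbb{T}^{\mathbb{R}})$ is the product $\sigma$-field on $\mathbb{T}^{\mathbb{R}}$ and $\mu^{\mathcal{Z}}$ is the law of $\mathcal{Z}$ on $(\mathbb{T}^{\mathbb{R}},\widehat{\mathcal{B}}(\mathbb{T}^{\mathbb{R}}))$.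 The shift is $\sigma_{\mathbb{T}}^t(x_s:s\in\mathbb{R})=(x_{s+t}:s\in\mathbb{R})$, so $(\sigma^t_{\mathbb{T}}\circ\mathcal{Z})_s=\mathcal{Z}_{s+t}$. A flow is a probability space with a family $(\psi^t:t\in\mathbb{R})$ of measure-preserving measurable transformations; it is a shift flow when $\psi^t$ are the shifts $\sigma^t$. *)

(* Defs.v *)
From HB Require Import structures.
From mathcomp Require Import all_boot all_order all_algebra finmap.
From mathcomp Require Import all_classical all_reals all_analysis.
From mathcomp Require Import lra.
Set Implicit Arguments.
Unset Strict Implicit.
Unset Printing Implicit Defensive.
Import Order.TTheory GRing.Theory Num.Theory.
Import numFieldNormedType.Exports.
Local Open Scope classical_set_scope.
Local Open Scope ring_scope.

(* The hyperspace of closed subsets of X, with the Fell topology: the sets of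
   closed F missing a given compact set, or hitting a given open set, form a
   subbase. *)
Record fell (X : topologicalType) := Fell {
  fell_set :> set X;
  fell_closed : closed fell_set }.

Section fell_topology.
Variable X : topologicalType.

HB.instance Definition _ := gen_eqMixin (fell X).
HB.instance Definition _ := gen_choiceMixin (fell X).
HB.instance Definition _ := isPointed.Build (fell X) (Fell (@closed0 X)).

Definition fell_subbase : set (set (fell X)) :=
  [set [set F : fell X | (F : set X) `&` K = set0] | K in @compact X] `|`
  [set [set F : fell X | (F : set X) `&` G !=set0] | G in @open X].

HB.instance Definition _ :=
  @isSubBaseTopological.Build (fell X) (set (fell X)) fell_subbase id.

Lemma fell_inj (F G : fell X) : (F : set X) = G -> F = G.
Proof.
case: F G => F cF [G cG] /= FG; subst G.
by congr Fell; exact: Prop_irrelevance.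
Qed.

Lemma fell_subbase_open (U : set (fell X)) : fell_subbase U -> open U.
Proof.
move=> bU; exists [set U]; last by rewrite bigcup_set1.
move=> _ ->; exists [fset U]%fset; last by rewrite set_fset1 bigcap_set1.
by move=> V /fset1P ->; apply/mem_set.
Qed.

Lemma open_fell_miss (K : set X) : compact K ->
  open [set F : fell X | (F : set X) `&` K = set0].
Proof. by move=> cK; apply: fell_subbase_open; left; exists K. Qed.

Lemma open_fell_hit (G : set X) : open G ->
  open [set F : fell X | (F : set X) `&` G !=set0].
Proof. by move=> oG; apply: fell_subbase_open; right; exists G. Qed.

Lemma fell_accessible : accessible_space (fell X).
Proof.
move=> F G /eqP FG.
have [[x [Fx Gx]]|FsubG] := pselect (exists x, fell_set F x /\ ~ fell_set G x).
  exists [set H : fell X | (H : set X) `&` ~` (G : set X) !=set0]; split.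
  - by apply: open_fell_hit; apply: closed_openC; exact: fell_closed.
  - by rewrite inE; exists x.
  - rewrite inE /= => -[y [Gy nGy]]; exact: nGy.
have [x [Gx Fx]] : exists x, fell_set G x /\ ~ fell_set F x.
  apply: contrapT => GsubF; apply: FG; apply: fell_inj.
  apply/seteqP; split => x Hx; apply: contrapT => nHx.
    by apply: FsubG; exists x.
  by apply: GsubF; exists x.
exists [set H : fell X | (H : set X) `&` [set x] = set0]; split.
- by apply: open_fell_miss; exact: compact_set1.
- by rewrite inE /= -subset0 => y [Fy yx]; apply: Fx; rewrite -yx.
- rewrite inE /= => H; have : @set0 X x by rewrite -H.
  by [].
Qed.

End fell_topology.

Definition borel (X : ptopologicalType) := g_sigma_algebraType (@open X).
HB.instance Definition _ (X : ptopologicalType) := Measurable.on (borel X).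

Section tessellations.
Variables (R : realType) (l : nat).
Local Notation E := 'rV[R]_l.+1.

Definition conv_hull (n : nat) (p : 'I_n -> E) : set E :=
  [set x | exists w : 'I_n -> R, [/\ forall i, 0 <= w i, \sum_i w i = 1 &
                                     x = \sum_i w i *: p i]].

Definition polytope (C : set E) : Prop :=
  (exists n (p : 'I_n -> E), C = conv_hull p) /\ C° !=set0.

(* For W = setT this is a tessellation of the whole space. For a compact W,
   local finiteness amounts to finiteness, and this is a finite tessellation
   of W. *)
Definition is_tessellation (W : set E) (F : set (set E)) : Prop :=
  [/\ F `<=` polytope,
      countable F,
      forall K : set E, compact K -> finite_set [set C | F C /\ C `&` K !=set0],
      forall C D, F C -> F D -> C <> D -> C° `&` D° = set0 &
      \bigcup_(C in F) C = W].

(* The nonempty closed subsets of W. As a type it carries the trace of the Fell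
   topology of fell E, which for closed W is the Fell topology of W. *)
Definition ne_closed (W : set E) : set (fell E) :=
  [set C | (C : set E) !=set0 /\ C `<=` W].

(* The elements of tess_space W are closed sets of points of ne_closed W;
   [cells] below recovers the underlying family of subsets of E. *)
Definition tess_space (W : set E) : set (fell (ne_closed W)) :=
  [set T | is_tessellation W [set fell_set (val C) | C in (T : set _)]].

Definition tess (W : set E) : Type := @tess_space W.

Definition cells (W : set E) (T : tess W) : set (set E) :=
  [set fell_set (val C) | C in (val T : set (ne_closed W))].

Lemma cells_inj (W : set E) : injective (@cells W).
Proof.
move=> S T ST; apply: val_inj; apply: fell_inj; apply/seteqP; split => C.
  move=> SC; have [D TD DC] : cells T (fell_set (val C)).
    by rewrite -ST; exists C.
  by rewrite (_ : C = D)//; apply: val_inj; apply: fell_inj.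
move=> TC; have [D SD DC] : cells S (fell_set (val C)).
  by rewrite ST; exists C.
by rewrite (_ : C = D)//; apply: val_inj; apply: fell_inj.
Qed.

Lemma conv_hull_compact n (p : 'I_n -> E) : compact (conv_hull p).
Proof.
pose S := [set w : 'rV[R]_n | (forall i, 0 <= w 0 i) /\ \sum_i w 0 i = 1].
have ce (i : 'I_n) : continuous (fun w : 'rV[R]_n => w 0 i).
  by move=> w; exact: coord_continuous.
have cs : continuous (fun w : 'rV[R]_n => \sum_i w 0 i).
  apply: (@continuous_big R^o 'I_n +%R 0 xpredT _ 'rV[R]_n (index_enum 'I_n)
    (fun i (w : 'rV[R]_n) => w 0 i)) => [|i _]; last exact: ce.
  exact: add_continuous.
have cS : compact S.
  have S1 : S = [set w : 'rV[R]_n | forall i, `[0, 1]%classic (w ord0 i)] `&`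
      ((fun w : 'rV[R]_n => \sum_i w 0 i) @^-1` [set 1]).
    apply/seteqP; split => w /=.
      move=> [w0 w1]; split => // i; rewrite in_itv/= w0/= -w1 (bigD1 i)//=.
      by rewrite lerDl sumr_ge0.
    by move=> [w01 w1]; split => // i; have := w01 i; rewrite in_itv/= => /andP[].
  rewrite S1; apply: compact_closedI.
    apply: (@rV_compact R n (fun=> `[0, 1]%classic)) => _.
    exact: segment_compact.
  apply: preimage_closed; last exact: closed_eq.
  by move=> w _; exact: cs.
have -> : conv_hull p = (fun w : 'rV[R]_n => \sum_i w 0 i *: p i) @` S.
  apply/seteqP; split => x.
    move=> [w [w0 w1 ->]]; exists (\row_i w i).
      by split; [move=> i; rewrite mxE | rewrite -w1; under eq_bigr do rewrite mxE].
    by apply: eq_bigr => i _; rewrite mxE.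
  by move=> [w [w0 w1] <-]; exists (fun i => w 0 i).
apply: continuous_compact => //; apply: continuous_subspaceT.
apply: (@continuous_big E 'I_n +%R 0 xpredT _ _ _
  (fun i (w : 'rV[R]_n) => w 0 i *: p i)) => [|i _ w].
  exact: add_continuous.
apply: (@cvgZr_tmp _ _ _ (nbhs w) _ (fun w : 'rV[R]_n => w 0 i)).
exact: (ce i w).
Qed.

Lemma polytope_compact (C : set E) : polytope C -> compact C.
Proof. by move=> [[n [p ->]] _]; exact: conv_hull_compact. Qed.

Lemma polytope_closed (C : set E) : polytope C -> closed C.
Proof. by move/polytope_compact; apply: compact_closed; exact: norm_hausdorff. Qed.

Lemma polytope_neq0 (C : set E) : polytope C -> C !=set0.
Proof. by move=> [_ [x /interior_subset Cx]]; exists x. Qed.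

Lemma ball_bounded_compact (x : E) :
  exists2 K : set E, compact K & ball x 1 `<=` K.
Proof.
exists [set y : E | forall i, `[x ord0 i - 1, x ord0 i + 1]%classic (y ord0 i)].
  apply: (@rV_compact R _ (fun i => `[x ord0 i - 1, x ord0 i + 1]%classic)) => i.
  exact: segment_compact.
move=> y [_ xy] i /=; have := xy ord0 i; rewrite /ball /= in_itv/= ltr_norml.
by move=> /andP[? ?]; rewrite lerBlDl -lerBlDr -lerBlDl; apply/andP; split; lra.
Qed.

Lemma locally_finite_closed (W : set E) (T : set (ne_closed W)) :
  (forall K : set E, compact K -> finite_set
    [set C | [set fell_set (val C) | C in T] C /\ C `&` K !=set0]) -> closed T.
Proof.
move=> finT F clTF; have [[x Fx] _] := set_valP F.
have [K cK xK] := ball_bounded_compact x.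
pose T1 : set (fell E) :=
  [set C | [set val D | D in T] C /\ (C : set E) `&` K !=set0].
have finT1 : finite_set T1.
  apply: (sub_finite_set _ (finite_image
    (fun S : set E => xget point [set C : fell E | fell_set C = S]) (finT K cK))).
  move=> _ [[D TD <-] DK]; exists (fell_set (val D)).
    by split => //; exists D.
  apply: fell_inj; apply: (@xgetPex _ point
    [set C : fell E | fell_set C = fell_set (val D)]).
  by exists (val D).
have clT1 : closed T1.
  have [H _] := @accessible_finite_set_closed (fell E); apply: H => //.
  exact: fell_accessible.
suff /clT1 [[D TD /val_inj <-//]] : closure T1 (val F).
move=> V nV.
have cv : continuous (fun C : ne_closed W => val C) by exact: initial_continuous.
pose H : set (fell E) := [set C | (C : set E) `&` ball x 1 !=set0].
have nH : nbhs (val F) H.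
  apply: open_nbhs_nbhs; split; first by apply: open_fell_hit; exact: ball_open.
  by exists x; split => //; exact: ballxx.
have [D [TD [VD [y [Dy xy]]]]] := clTF _ (cv F _ (filterI nV nH)).
exists (val D); split => //; split; first by exists D.
by exists y; split => //; exact: xK.
Qed.

Lemma tess_of_subproof (W : set E) (F : set (set E)) (hF : is_tessellation W F) :
  closed [set C : ne_closed W | F (fell_set (val C))].
Proof.
have [_ _ finF _ _] := hF; apply: locally_finite_closed => K cK.
apply: sub_finite_set (finF K cK) => _ [[C FC <-] CK]; split => //.
Qed.

Lemma tess_of_cells (W : set E) (F : set (set E)) (hF : is_tessellation W F) :
  [set fell_set (val C) | C in [set C : ne_closed W | F (fell_set (val C))]] = F.
Proof.
have [pF _ _ _ FW] := hF; apply/seteqP; split => [_ [C FC <-]//|C FC].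
have CW : ne_closed W (Fell (polytope_closed (pF C FC))).
  split; first exact: polytope_neq0 (pF C FC).
  by move=> x Cx; rewrite -FW; exists C.
by exists (SigSub (mem_set CW)).
Qed.

Lemma tess_of_mem (W : set E) (F : set (set E)) (hF : is_tessellation W F) :
  Fell (tess_of_subproof hF) \in @tess_space W.
Proof. by apply/mem_set; rewrite /tess_space /= tess_of_cells. Qed.

Definition tess_of (W : set E) (F : set (set E)) (hF : is_tessellation W F) :
  tess W := SigSub (tess_of_mem hF).

Lemma cells_tess_of (W : set E) (F : set (set E)) (hF : is_tessellation W F) :
  cells (tess_of hF) = F.
Proof. exact: tess_of_cells. Qed.

Lemma tess_cells (W : set E) (T : tess W) : is_tessellation W (cells T).
Proof. exact: (set_valP T). Qed.

Lemma tess_set1 (W : set E) : polytope W -> is_tessellation W [set W].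
Proof.
move=> pW; split.
- by move=> _ ->.
- exact: countable1.
- by move=> K _; apply: sub_finite_set (finite_set1 W) => C [].
- by move=> C D -> ->.
- by rewrite bigcup_set1.
Qed.

Definition dilate (c : R) (A : set E) : set E := [set c *: x | x in A].

Lemma dilateE (c : R) (A : set E) : c != 0 ->
  dilate c A = (fun x => c^-1 *: x) @^-1` A.
Proof.
move=> c0; apply/seteqP; split => [_ [x Ax <-]|x Ax] /=.
  by rewrite scalerA mulVf// scale1r.
by exists (c^-1 *: x) => //; rewrite scalerA divff// scale1r.
Qed.

Lemma dilateK (c : R) : c != 0 -> cancel (dilate c) (dilate c^-1).
Proof.
move=> c0 A; rewrite !dilateE ?invr_neq0//; apply/seteqP; split => x /=;
  by rewrite !scalerA invrK mulVf// scale1r.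
Qed.

Lemma scaler_cont (c : R) : continuous (fun x : E => c *: x).
Proof. exact: scaler_continuous. Qed.

Lemma dilate_interior (c : R) (A : set E) : c != 0 ->
  (dilate c A)° = dilate c A°.
Proof.
move=> c0.
have sub (d : R) (B : set E) : d != 0 -> dilate d B° `<=` (dilate d B)°.
  move=> d0; rewrite -open_subsetE; last first.
    rewrite dilateE//; apply: open_comp; last exact: open_interior.
    by move=> x _; exact: scaler_cont.
  by move=> _ [x /interior_subset Bx <-]; exists x.
apply/seteqP; split; last exact: sub.
move=> x; have := @sub c^-1 (dilate c A); rewrite dilateK// invr_neq0//.
move=> /(_ isT) H Ax; exists (c^-1 *: x); last by rewrite scalerA divff// scale1r.
by apply: H; exists x.
Qed.

Lemma dilate_polytope (c : R) (C : set E) : c != 0 ->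
  polytope C -> polytope (dilate c C).
Proof.
move=> c0 [[n [p ->]] [x Cx]]; split; last first.
  by rewrite dilate_interior//; exists (c *: x); exists x.
exists n, (fun i => c *: p i); apply/seteqP; split.
  move=> _ [_ [w [w0 w1 ->]] <-]; exists w; split => //.
  by rewrite scaler_sumr; apply: eq_bigr => i _; rewrite !scalerA mulrC.
move=> _ [w [w0 w1 ->]]; exists (\sum_i w i *: p i); first by exists w.
by rewrite scaler_sumr; apply: eq_bigr => i _; rewrite !scalerA mulrC.
Qed.

Lemma dilate_tess (c : R) (F : set (set E)) : c != 0 ->
  is_tessellation setT F -> is_tessellation setT [set dilate c C | C in F].
Proof.
move=> c0 [pF cF fF dF uF]; split.
- by move=> _ [C FC <-]; apply: dilate_polytope => //; exact: pF.
- exact: sub_countable (card_image_le _ _) cF.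
- move=> K cK.
  have cK' : compact (dilate c^-1 K).
    apply: continuous_compact => //; apply: continuous_subspaceT.
    exact: scaler_cont.
  apply: sub_finite_set (finite_image (dilate c) (fF _ cK')).
  move=> _ [[C FC <-] [_ [[x Cx <-] Kx]]]; exists C => //; split => //.
  exists x; split => //; exists (c *: x) => //.
  by rewrite scalerA mulVf// scale1r.
- move=> _ _ [C FC <-] [D FD <-] CD; rewrite !dilate_interior//.
  have CD' : C <> D by move=> CD'; apply: CD; rewrite CD'.
  rewrite -subset0 => _ [[x Cx <-] [y Dy]] /(scalerI c0) yx.
  have : (C° `&` D°) x by split => //; rewrite -yx.
  by rewrite dF.
- rewrite -subTset => x _.
  have : [set: E] (c^-1 *: x) by [].
  rewrite -uF => -[C FC Cx]; exists (dilate c C); first by exists C.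
  by exists (c^-1 *: x) => //; rewrite scalerA divff// scale1r.
Qed.

Definition tdilate (c : R) (c0 : c != 0) (T : tess setT) : tess setT :=
  tess_of (dilate_tess c0 (tess_cells T)).

Lemma cells_tdilate (c : R) (c0 : c != 0) (T : tess setT) :
  cells (tdilate c0 T) = [set dilate c C | C in cells T].
Proof. exact: cells_tess_of. Qed.

Definition unit_cube (k : 'rV[int]_l.+1) : set E :=
  [set x : E | forall i, (k 0 i)%:~R <= x 0 i <= (k 0 i)%:~R + 1].

Lemma unit_cube_hull (k : 'rV[int]_l.+1) :
  unit_cube k = conv_hull (fun j : 'I_#|{: {ffun 'I_l.+1 -> bool}}| =>
    \row_i ((k 0 i)%:~R + (enum_val j i)%:R)).
Proof.
apply/seteqP; split => x; last first.
  move=> [w [w0 w1 ->]] i; rewrite summxE.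
  have eqw (c : R) : c = \sum_j w j * c by rewrite -mulr_suml w1 mul1r.
  apply/andP; split; [rewrite [leLHS]eqw|rewrite [leRHS]eqw];
    apply: ler_sum => j _; rewrite !mxE;
    by apply: ler_wpM2l => //; case: (enum_val j i); rewrite /= ?mulr1n ?mulr0n; lra.
move=> kx; pose u i := x 0 i - (k 0 i)%:~R.
pose q i (b : bool) := if b then u i else 1 - u i.
pose w (f : {ffun 'I_l.+1 -> bool}) := \prod_i q i (f i).
have q0 i b : 0 <= q i b.
  by have /andP[? ?] := kx i; rewrite /q /u; case: b; lra.
have q1 i : \sum_b q i b = 1 by rewrite big_bool /= /q addrC subrK.
have w1 : \sum_f w f = 1.
  by rewrite -(bigA_distr_bigA q) big1.
have wj j : \sum_f w f * (f j)%:R = u j.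
  pose q' i b := q i b * (if i == j then b%:R else 1).
  transitivity (\sum_(f : {ffun 'I_l.+1 -> bool}) \prod_i q' i (f i)).
    apply: eq_bigr => f _; rewrite /w big_split /=; congr (_ * _).
    by rewrite -big_mkcond /= big_pred1_eq.
  rewrite -(bigA_distr_bigA q') (bigD1 j)//= [X in _ * X]big1 => [|i ij].
    by rewrite big_bool /q' eqxx /= !mulr1 mulr0 addr0.
  by rewrite -(q1 i); apply: eq_bigr => b _; rewrite /q' (negbTE ij) mulr1.
exists (fun j => w (enum_val j)); split.
- by move=> j; apply: prodr_ge0 => i _.
- by rewrite -w1 (big_enum_val w).
- apply/rowP => i; rewrite summxE.
  rewrite -(big_enum_val (fun f : {ffun 'I_l.+1 -> bool} =>
    (w f *: (\row_i0 ((k 0 i0)%:~R + (f i0)%:R) : E)) 0 i)).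
  under eq_bigr do rewrite !mxE mulrDr.
  by rewrite big_split /= -mulr_suml w1 mul1r wj /u addrC subrK.
Qed.

Lemma unit_cube_interior (k : 'rV[int]_l.+1) (x : E) : (unit_cube k)° x ->
  forall i, (k 0 i)%:~R < x 0 i < (k 0 i)%:~R + 1.
Proof.
move=> /nbhs_ballP[e /= e0 xe] i.
have e2 (d : R) : `|d| < e -> unit_cube k (x + d *: delta_mx 0 i).
  move=> de; apply: xe; split => // a j; rewrite (ord1 a) /ball /= !mxE eqxx /=.
  rewrite opprD addrA subrr add0r normrN normrM.
  by apply: le_lt_trans de; rewrite ler_piMr//; case: eqP; rewrite ?normr1 ?normr0.
have h : `|e / 2| < e by rewrite ger0_norm; lra.
have /andP[_] := e2 (e / 2) h i; rewrite !mxE !eqxx /= mulr1 => xk.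
have h' : `|- (e / 2)| < e by rewrite normrN.
have /andP[kx _] := e2 (- (e / 2)) h' i; move: kx; rewrite !mxE !eqxx /= mulr1.
by move=> kx; apply/andP; split; lra.
Qed.

Lemma unit_cube_polytope (k : 'rV[int]_l.+1) : polytope (unit_cube k).
Proof.
split; first by rewrite unit_cube_hull; do 2 eexists.
exists (\row_i ((k 0 i)%:~R + 2^-1)); apply/nbhs_ballP.
exists (2^-1) => /=; first by rewrite invr_gt0.
move=> y [_ xy] i; have := xy 0 i; rewrite /ball /= !mxE ltr_norml => /andP[? ?].
by apply/andP; split; lra.
Qed.

Lemma unit_cubes_tess : is_tessellation setT (range unit_cube).
Proof.
split.
- by move=> _ [k _ <-]; exact: unit_cube_polytope.
- exact: sub_countable (card_image_le _ _) (countableP _).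
- move=> K cK.
  have [M [_ KM]] := compact_bounded cK.
  pose N := (Num.truncn (`|M| + 1)).+2.
  pose g (f : {ffun 'I_l.+1 -> 'I_(N + N)}) : 'rV[int]_l.+1 :=
    \row_i ((f i)%:Z - N%:Z).
  have fg : finite_set (range (unit_cube \o g)) by apply: finite_image.
  apply: sub_finite_set fg => _ [[k _ <-] [x [kx Kx]]].
  have MN : `|M| + 2 < N%:R.
    have := truncnS_gt (`|M| + 1); rewrite /N -[X in _ -> _ < X]natr1; lra.
  have xM i : `|x 0 i| < N%:R - 1.
    have xM : `|x| <= `|M| + 1.
      by apply: (KM (`|M| + 1)) Kx; rewrite (le_lt_trans (ler_norm M)) ?ltrDl.
    apply: le_lt_trans (_ : _ <= `|x|) _; last lra.
    have /mapP[j Hj ->] : `|x 0 i| \in [seq `|x y.1 y.2| | y : 'I_1 * 'I_l.+1].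
      by apply/mapP; exists (0, i) => //=; rewrite mem_enum.
    rewrite [leRHS]/Num.Def.normr /= mx_normrE.
    by apply/bigmax_geP; right => /=; exists j.
  have kN i : 0 <= k 0 i + N%:Z < (N + N)%:Z.
    have /andP[k1 k2] := kx i; have := xM i; rewrite ltr_norml => /andP[? ?].
    rewrite -(ler_int R) -(ltr_int R) !intrD/=.
    by apply/andP; split; rewrite -!pmulrn ?natrD; lra.
  have kN' i : (absz (k ord0 i + N%:Z)%R < N + N)%N.
    by have /andP[? ?] := kN i; rewrite -ltz_nat gez0_abs.
  exists [ffun i => Ordinal (kN' i)] => //=; congr unit_cube; apply/rowP => i.
  by rewrite mxE ffunE /= gez0_abs ?addrK//; case/andP: (kN i).
- move=> _ _ [k _ <-] [k' _ <-] kk'; rewrite -subset0 => x [xk xk'].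
  apply: kk'; congr unit_cube; apply/rowP => i.
  have := unit_cube_interior xk i; have := unit_cube_interior xk' i.
  move=> /andP[? ?] /andP[? ?].
  have fE (m : int) : m%:~R < x 0 i -> x 0 i < m%:~R + 1 -> Num.floor (x 0 i) = m.
    by move=> mx xm; apply: floor_def; rewrite (ltW mx) intrD.
  by rewrite -(fE (k 0 i))// -(fE (k' 0 i)).
- rewrite -subTset => x _; exists (unit_cube (\row_i Num.floor (x 0 i))).
    by exists (\row_i Num.floor (x 0 i)).
  move=> i; rewrite mxE; have /andP[-> /ltW] := floor_itv (x 0 i).
  by rewrite intrD.
Qed.

Record window := Window {
  window_set :> set E;
  window_polytope : polytope window_set }.

(* The family of cells of T /\ W, for F the family of cells of T. *)
Definition tess_restrict (W : set E) (F : set (set E)) : set (set E) :=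
  [set C `&` W | C in [set C | F C /\ (C `&` W)° !=set0]].

Definition dot (u x : E) : R := \sum_i u 0 i * x 0 i.

Definition hyperplane_space : set (fell E) :=
  [set H | exists (u : E) (r : R), u != 0 /\ fell_set H = [set x | dot u x = r]].

Lemma dot_continuous (u : E) : continuous (dot u).
Proof.
apply: (@continuous_big R^o 'I_l.+1 +%R 0 xpredT _ _ _
  (fun i (x : E) => u 0 i * x 0 i)) => [|i _ x].
  exact: add_continuous.
apply: (@cvgM _ _ (nbhs x) _ (fun=> u 0 i) (fun x : E => x 0 i)).
  exact: cvg_cst.
exact: coord_continuous.
Qed.

Lemma hyperplane_closed (u : E) (r : R) : closed [set x | dot u x = r].
Proof.
apply: (@preimage_closed _ _ (dot u) [set r]); last exact: closed_eq.
by move=> x _; exact: dot_continuous.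
Qed.

Lemma hyperplane_point_subproof :
  Fell (@hyperplane_closed (delta_mx 0 0) 0) \in hyperplane_space.
Proof.
apply/mem_set; exists (delta_mx 0 0), 0; split => //.
by apply/eqP => /rowP/(_ 0)/eqP; rewrite !mxE !eqxx oner_eq0.
Qed.

End tessellations.

Section spaces.
Variables (R : realType) (l : nat).
Local Notation E := 'rV[R]_l.+1.

(* The types R l below live in dimension l.+1, so that the dimension is >= 1.
   The point required by measurableType is the cubic lattice tessellation. *)
Definition tessellation : Type := @tess R l setT.
HB.instance Definition _ := Choice.copy tessellation (@tess_space R l setT).
HB.instance Definition _ :=
  isPointed.Build tessellation (tess_of (@unit_cubes_tess R l)).
Definition tessellation_val (T : tessellation) :
  borel (fell (@ne_closed R l setT)) := val T.
HB.instance Definition _ := Measurable.copy tessellation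
  (g_sigma_algebra_preimageType tessellation_val).

Definition window_tess (W : window R l) : Type := tess W.
HB.instance Definition _ (W : window R l) :=
  Choice.copy (window_tess W) (@tess_space R l W).
HB.instance Definition _ (W : window R l) :=
  isPointed.Build (window_tess W) (tess_of (tess_set1 (window_polytope W))).
Definition window_tess_val (W : window R l) (T : window_tess W) :
  borel (fell (@ne_closed R l W)) := val T.
HB.instance Definition _ (W : window R l) := Measurable.copy (window_tess W)
  (g_sigma_algebra_preimageType (@window_tess_val W)).

Definition hyperplane : Type := @hyperplane_space R l.
HB.instance Definition _ := Topological.copy hyperplane (@hyperplane_space R l).
HB.instance Definition _ :=
  isPointed.Build hyperplane (SigSub (@hyperplane_point_subproof R l)).
Definition hyperplane_val (H : hyperplane) : borel (fell E) := val H.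
HB.instance Definition _ := Measurable.copy hyperplane
  (g_sigma_algebra_preimageType hyperplane_val).
Definition hyperplane_set (H : hyperplane) : set E := fell_set (val H).

End spaces.

Section processes.

(* The sigma-field generated by the X i, for i in J. *)
Definition sigma_gen (I Omega : Type) d (T : measurableType d) (J : set I)
    (X : I -> Omega -> T) : set_system Omega :=
  <<s \bigcup_(i in J) preimage_set_system setT (X i) measurable >>.

(* T^I with the product sigma-field. *)
Definition paths (I : Type) d (T : measurableType d) : Type := I -> T.

HB.instance Definition _ (I : Type) d (T : measurableType d) :=
  Pointed.copy (paths I T) (I -> T).
HB.instance Definition _ (I : Type) d (T : measurableType d) :=
  Measurable.copy (paths I T) (g_sigma_algebraType
    (\bigcup_(i in [set: I])
       preimage_set_system setT (fun x : paths I T => x i) measurable)).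

Definition trajectory (I Omega : Type) d (T : measurableType d)
  (X : I -> Omega -> T) (w : Omega) : paths I T := fun i => X i w.

Definition same_law (R : realType) d (S : measurableType d)
    d1 (O1 : measurableType d1) (P1 : probability O1 R) (X1 : O1 -> S)
    d2 (O2 : measurableType d2) (P2 : probability O2 R) (X2 : O2 -> S) : Prop :=
  forall A : set S, measurable A -> P1 (X1 @^-1` A) = P2 (X2 @^-1` A).

(* g is a version of the conditional probability P(A | G), for a sub-sigma-field
   G. *)
Definition is_cond_prob (R : realType) d (Omega : measurableType d)
    (P : probability Omega R) (G : set_system Omega) (A : set Omega)
    (g : Omega -> R) : Prop :=
  (forall U : set R, measurable U -> G (g @^-1` U)) /\
  (forall B, G B -> P (A `&` B) = \int[P]_(w in B) (g w)%:E)%E.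

(* Markov property with respect to the natural filtration: the conditional
   probability of X_t \in A given (X_u, u <= s) is a function of X_s. *)
Definition markov_process (R : realType) d (Omega : measurableType d)
    (P : probability Omega R) d' (T : measurableType d')
    di (I : porderType di) (X : I -> Omega -> T) : Prop :=
  forall (s t : I) (A : set T), (s <= t)%O -> measurable A ->
  exists2 g : T -> R, measurable_fun setT g &
    is_cond_prob P (sigma_gen [set u | (u <= s)%O] X) (X t @^-1` A) (g \o X s).

Definition path_shift (R : realType) d (T : measurableType d) (t : R)
  (x : paths R T) : paths R T := fun s => x (s + t).

Definition is_flow (R : realType) d (S : measurableType d)
    (mu : probability S R) (psi : R -> S -> S) : Prop :=
  forall t, measurable_fun setT (psi t) /\
    forall A, measurable A -> mu (psi t @^-1` A) = mu A.

End processes.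

Section stit.
Variables (R : realType) (l : nat).
Local Notation E := 'rV[R]_l.+1.
Local Notation H := (hyperplane R l).
Variable Lambda : {measure set H -> \bar R}.

Definition hitting (B : set E) : set H :=
  [set h | hyperplane_set h `&` B !=set0].

Definition translate (x : E) (A : set H) : set H :=
  [set h | exists2 h', A h' &
     hyperplane_set h = [set x + y | y in hyperplane_set h']].

Definition msupport : set H :=
  [set h | forall U : set H, open U -> U h -> (0 < Lambda U)%E].

Definition parallel_to (u : E) (h : H) : Prop :=
  forall (y : E) (c : R), hyperplane_set h y -> hyperplane_set h (y + c *: u).

(* Lambda (hitting W) > 0 is not required: it follows from the other conditions
   since countably many translates of W cover the space. Finiteness does not
   follow from sigma-finiteness and translation invariance. *)
Definition driving_measure : Prop :=
  [/\ Lambda setT != 0%E,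
      sigma_finite setT Lambda,
      forall x A, measurable A -> Lambda (translate x A) = Lambda A,
      forall W : window R l, (Lambda (hitting W) < +oo)%E &
      ~ exists2 u : E, u != 0 & forall h, msupport h -> parallel_to u h].

(* The two closed half-spaces bounded by h. They are told apart by the normal
   vector u whose first nonzero coordinate is 1, which only serves to label the
   two parts of a divided cell in a measurable way. *)
Definition side (b : bool) (h : H) : set E :=
  [set x | exists (u : E) (r : R),
    [/\ exists i, u 0 i = 1 /\ forall j : 'I_l.+1, (j < i)%N -> u 0 j = 0,
        hyperplane_set h = [set y | dot u y = r] &
        if b then r <= dot u x else dot u x <= r]].

(* A cell of the process in a window is coded by a word: [::] is the window
   itself, and b :: v is the part of v on side b of the hyperplane that divides
   v. A mark m gives the lifetime and the dividing hyperplane of every cell. *)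
Definition marks : Type := paths (seq bool) (R * H)%type.
HB.instance Definition _ := Measurable.copy marks (paths (seq bool) (R * H)%type).

Definition lifetime (m : marks) (v : seq bool) : R := (m v).1.
Definition divider (m : marks) (v : seq bool) : H := (m v).2.

Fixpoint cell (W : set E) (m : marks) (v : seq bool) : set E :=
  if v is b :: v' then cell W m v' `&` side b (divider m v') else W.

Fixpoint birth (m : marks) (v : seq bool) : R :=
  if v is b :: v' then birth m v' + lifetime m v' else 0.

Definition rate (C : set E) : R := fine (Lambda (hitting C)).

(* The law Exp(Lambda [C]) (x) Lambda_C of the lifetime and of the dividing
   hyperplane of the cell C, evaluated on A x B. *)
Definition split_prob (C : set E) (A : set R) (B : set H) : R :=
  fine (exponential_prob (rate C) A) * (fine (Lambda (B `&` hitting C)) / rate C).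

(* Given the marks of all words of length < n, which determine the cells coded
   by the words of length n, the marks of the latter are independent, each with
   the law [split_prob] of its cell. *)
Definition marks_law (W : set E) (Q : probability marks R) : Prop :=
  forall (n : nat) (A : n.-tuple bool -> set R) (B : n.-tuple bool -> set H),
    (forall v, measurable (A v)) -> (forall v, measurable (B v)) ->
    is_cond_prob Q
      (sigma_gen [set v : seq bool | (size v < n)%N] (fun v (m : marks) => m v))
      [set m | forall v : n.-tuple bool, A v (lifetime m v) /\ B v (divider m v)]
      (fun m => \prod_(v : n.-tuple bool) split_prob (cell W m v) (A v) (B v)).

(* X has the law of the process starting from {W} whose cells alive at time t
   are those v such that birth v <= t < birth v + lifetime v. On a Q-null set
   these cells may fail to form a tessellation, whence the process X'. *)
Definition window_process (W : window R l) d (Omega : measurableType d)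
    (P : probability Omega R) (X : {nonneg R} -> Omega -> window_tess W) : Prop :=
  (forall t, measurable_fun setT (X t)) /\
  exists (Q : probability marks R) (X' : {nonneg R} -> marks -> window_tess W),
    [/\ marks_law W Q,
        forall t, measurable_fun setT (X' t),
        {ae Q, forall m, forall t, cells (X' t m) =
          [set cell W m v | v in [set v |
             birth m v <= t%:num < birth m v + lifetime m v]]} &
        same_law P (trajectory X) Q (trajectory X')].

(* X is the process Y /\ W. *)
Definition stit_process d (Omega : measurableType d) (P : probability Omega R)
    (Y : {posnum R} -> Omega -> tessellation R l) : Prop :=
  [/\ forall t, measurable_fun setT (Y t),
      markov_process P Y &
      forall W : window R l, exists X : {nonneg R} -> Omega -> window_tess W,
        [/\ forall w, cells (X 0%:nng w) = [set window_set W],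
            forall (t : {posnum R}) w,
              cells (X (t%:num)%:nng w) = tess_restrict W (cells (Y t w)) &
            window_process P X]].

End stit.

(* Main.v *)
From HB Require Import structures.
Require Import Defs.
From mathcomp Require Import all_boot all_order all_algebra finmap.
From mathcomp Require Import all_classical all_reals all_analysis measurable_realfun.
From mathcomp Require Import lra ring.

(** A translation invariant measure [Lambda] on hyperplanes is homogeneous: on
the hyperplanes transversal to a coordinate axis, translations along this axis
shift the intercept, so that the measure of the hyperplanes with directions in a
given set and intercept between [p] and [q] is proportional to [q - p]; as
dilating by [c] multiplies intercepts by [c], [Lambda (c A) = c * Lambda A].

Let [W] be a window. Dividing lifetimes by [c] and dilating the dividing
hyperplanes by [c] turns the marks of the process in the window [W / c] into
marks whose cells in [W] are [c] times as large. By homogeneity of [Lambda] and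
of the exponential laws, the image has the marks law of [W], and this law is
unique by induction on the length of the words. Hence [(c Y_(c t))_t] and
[(Y_t)_t] agree on the events that some cell of the tessellation at time [t] hits
given open balls and misses a given compact set: when the balls and the compact
set lie in [W] these events depend on the restriction to [W] only, and their
finite intersections form a pi-system generating the product sigma-field. With
[c = a^s] this is the stationarity of [Z]. *)

Set Implicit Arguments.
Unset Strict Implicit.
Unset Printing Implicit Defensive.
Import Order.TTheory GRing.Theory Num.Theory.
Import numFieldNormedType.Exports.
Local Open Scope classical_set_scope.
Local Open Scope ring_scope.

(** * Path spaces and Fell spaces *)

(** The good sets principle: a claim about preimages of all measurable sets need only be checked on
    a generating class. *)
Lemma sigma_algebra_preimageT (T U : Type) (f : T -> U) (G : set_system T) :
  sigma_algebra setT G -> sigma_algebra setT [set B | G (f @^-1` B)].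
Proof.
move=> /(sigma_algebra_image f); congr (sigma_algebra _ _).
by apply/seteqP; split => A; rewrite /image_set_system /= setTI.
Qed.

Section path_space.
Variables (I : Type) (d : measure_display) (T : measurableType d).

Lemma measurable_path (i : I) : measurable_fun setT (fun x : paths I T => x i).
Proof. by move=> _ A mA; apply: sub_sigma_algebra; exists i => //; exists A. Qed.

Lemma measurable_paths d' (S : measurableType d') (f : S -> paths I T) :
  (forall i, measurable_fun setT (fun w => f w i)) -> measurable_fun setT f.
Proof.
move=> mf _ A mA; rewrite setTI.
suff : [set A | measurable (f @^-1` A)] A by [].
move: A mA; apply: smallest_sub.
  by apply: sigma_algebra_preimageT; exact: sigma_algebra_measurable.
move=> _ [i _ [A mA <-]]; rewrite /= setTI.
by rewrite -[X in measurable X]setTI; exact: mf.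
Qed.

End path_space.

Definition hits (X : Type) (b : bool) (A : set X) : set (set X) :=
  if b then [set F | F `&` A !=set0] else [set F | F `&` A = set0].

Section fell_base.
Variables (X : topologicalType) (I : eqType) (o : bool -> I -> set X).

(** [o] depends on the boolean because, for the rational balls below, the sets to be hit are open
    and the sets to be missed are compact. *)
Definition fell_cyl (s : seq (bool * I)) : set (fell X) :=
  [set F | forall p, p \in s -> hits p.1 (o p.1 p.2) F].

Lemma fell_cyl_cat s t : fell_cyl (s ++ t) = fell_cyl s `&` fell_cyl t.
Proof.
apply/seteqP; split => F.
  by move=> st; split => p ps; apply: st; rewrite mem_cat ps ?orbT.
by move=> [hs ht] p; rewrite mem_cat => /orP[]; [exact: hs|exact: ht].
Qed.

Hypothesis o_true : forall U x, open U -> U x ->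
  exists2 i, o true i x & o true i `<=` U.
Hypothesis o_false : forall U x, open U -> U x ->
  exists2 i, nbhs x (o false i) & o false i `<=` U.

(* Missing a compact set [K] follows from missing finitely many [o false i] whose
   interiors cover [K]; the filter of the index lists containing a given list
   turns this into the near covering property of [K]. *)
Lemma fell_subbase_cyl (U : set (fell X)) (F : fell X) : fell_subbase U -> U F ->
  exists2 s, fell_cyl s F & fell_cyl s `<=` U.
Proof.
move=> [[K cK <-]|[G oG <-]] /=; last first.
  move=> [x [Fx Gx]]; have [i ix iG] := o_true oG Gx.
  exists [:: (true, i)]; first by move=> p; rewrite inE => /eqP -> /=; exists x.
  move=> H /(_ (true, i) (mem_head _ _)) [y [Hy iy]].
  by exists y; split => //; exact: iG.
move=> FK.
pose big (P : set (seq (bool * I))) (s0 : seq (bool * I)) :=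
  forall s : seq (bool * I), {subset s0 <= s} -> P s.
pose FS : set_system (seq (bool * I)) :=
  [set P | exists2 s0, fell_cyl s0 F & big P s0].
have filtF : Filter FS.
  split; first by exists [::].
  - move=> P Q [s Fs Ps] [t Ft Qt]; exists (s ++ t).
      by rewrite fell_cyl_cat.
    move=> u stu; split; [apply: Ps|apply: Qt] => p pi; apply: stu;
      by rewrite mem_cat pi ?orbT.
  - by move=> P Q PQ [s Fs Ps]; exists s => // t /Ps /PQ.
have /compact_near_coveringP/(_ _ FS (fun s x =>
    exists2 i, (false, i) \in s & o false i x) filtF) := cK.
case=> [x Kx|s0 Fs0 Hs0].
  have : (~` (F : set X)) x by move=> Fx; rewrite -[False]/(set0 x) -FK.
  move=> /(o_false (closed_openC (@fell_closed _ F)))[i ix iF].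
  exists (o false i, [set s : seq (bool * I) | (false, i) \in s]).
    split => //=; exists [:: (false, i)].
      move=> p; rewrite inE => /eqP ->; rewrite /hits /=; apply/seteqP; split => //.
      by move=> y [Fy iy]; exact: iF Fy.
    by move=> s ss; apply/ss/mem_head.
  by move=> [y s] /= [iy si]; exists i.
exists s0 => // H Hs /=; rewrite -subset0 => x [Hx Kx].
have [i si ix] := Hs0 s0 (fun=> id) x Kx.
have Hi : (H : set X) `&` o false i = set0 := Hs _ si.
by have : ((H : set X) `&` o false i) x by []; rewrite Hi.
Qed.

Lemma fell_open_cyl (U : set (fell X)) (F : fell X) : open U -> U F ->
  exists2 s, fell_cyl s F & fell_cyl s `<=` U.
Proof.
move=> [D' sD <-] [V D'V VF].
have [D sDb DV] := sD _ D'V.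
suff: exists2 s, fell_cyl s F & fell_cyl s `<=` \bigcap_(i in [set` D]) i.
  move=> [s Fs sV]; exists s => //; apply: subset_trans sV _.
  by rewrite DV => y Vy; exists V.
move: VF; rewrite -DV => VF {D' sD D'V V DV}.
have {sDb} : forall U, U \in enum_fset D -> fell_subbase U /\ U F.
  by move=> U' UD; split; [apply/set_mem/sDb|exact: VF].
suff : forall L : seq (set (fell X)), (forall U, U \in L -> fell_subbase U /\ U F) ->
    exists2 s, fell_cyl s F & forall H U, U \in L -> fell_cyl s H -> U H.
  move=> /[apply] -[s Fs sL]; exists s => // H Hs U' UD.
  exact: sL UD Hs.
elim=> [_|V L IH VL]; first by exists [::].
have [|s Fs sL] := IH; first by move=> W WL; apply: VL; rewrite inE WL orbT.
have [bV VF'] := VL _ (mem_head _ _).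
have [t Ft tV] := fell_subbase_cyl bV VF'.
exists (s ++ t); first by rewrite fell_cyl_cat.
move=> H W; rewrite fell_cyl_cat inE => /orP[/eqP ->|WL] [Hs Ht].
  exact: tV.
exact: sL WL Hs.
Qed.

End fell_base.

Section fell_preimage.
Variables (X : topologicalType) (I : countType) (o : I -> set X).
Hypothesis o_open : forall i, open (o i).
Hypothesis o_base : forall U x, open U -> U x -> exists2 i, o i x & o i `<=` U.

(* A compact set can be missed only by missing finitely many [o i] covering it, so
   that each open set of [fell X] is a countable union of finite intersections of
   sets [hits b (o i)]: the hits of basic open sets generate the Borel sets. *)
Lemma fell_preimage_gen (T : Type) (f : T -> fell X) (G : set_system T) :
  sigma_algebra setT G ->
  (forall i, G (f @^-1` [set F | (F : set X) `&` o i !=set0])) ->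
  forall B, <<s @open (fell X) >> B -> G (f @^-1` B).
Proof.
move=> sG Go B; pose H := [set B | G (f @^-1` B)].
have sH : sigma_algebra setT H by exact: sigma_algebra_preimageT.
have [G0 GC GU] := sG; have GT : G setT by rewrite -(setD0 setT); exact: GC.
have GI A1 A2 : G A1 -> G A2 -> G (A1 `&` A2).
  move=> G1 G2; rewrite -(setCK (A1 `&` A2)) setCI -setTD; apply/GC.
  rewrite -bigcup2E; apply: GU => -[|[|n]] //=; rewrite -setTD; exact: GC.
suff : <<s @open (fell X) >> `<=` H by apply.
apply: smallest_sub => // {}B oB.
pose O := fun (_ : bool) => o.
have Gcyl s : G (f @^-1` fell_cyl O s).
  elim: s => [|[b i] s IH].
    by rewrite [X in G X](_ : _ = setT)//; apply/seteqP; split.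
  rewrite -cat1s fell_cyl_cat preimage_setI; apply: GI => //.
  have {}Go := Go i.
  have -> : f @^-1` fell_cyl O [:: (b, i)] =
      if b then f @^-1` [set F | (F : set X) `&` o i !=set0]
      else ~` (f @^-1` [set F | (F : set X) `&` o i !=set0]).
    apply/seteqP; split => x; case: b => /=.
    - by move=> /(_ (true, i) (mem_head _ _)).
    - move=> /(_ (false, i) (mem_head _ _)); rewrite /hits /= => -> [y []].
    - by move=> xi p; rewrite inE => /eqP ->.
    - by move=> xi p; rewrite inE => /eqP -> /=; apply: contrapT => /eqP/set0P.
  by case: b => //; rewrite -setTD; exact: GC.
have -> : H B = G (\bigcup_(s in [set s | fell_cyl O s `<=` B])
    f @^-1` fell_cyl O s).
  rewrite /H /=; congr G; apply/seteqP; split => x /=.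
    have o_false U y : open U -> U y ->
        exists2 i, nbhs y (O false i) & O false i `<=` U.
      move=> oU Uy; have [i iy iU] := o_base oU Uy; exists i => //.
      exact: open_nbhs_nbhs.
    move=> Bx; have [s xs sB] := fell_open_cyl (o := O) (@o_base) o_false oB Bx.
    by exists s.
  by move=> [s sB]; exact: sB.
rewrite bigcup_mkcond; set C := fun s => if _ then _ else _.
(* There are countably many lists, so the union is reindexed by natural numbers, with the empty set
   at numbers that code no list. *)
rewrite (_ : \bigcup_ _ _ = \bigcup_n oapp C set0 (choice.unpickle n)); last first.
  apply/seteqP; split => x.
    by move=> [s _ sx]; exists (choice.pickle s) => //; rewrite choice.pickleK.
  by move=> [n _]; case: choice.unpickle => //= s sx; exists s.
by apply: GU => n; case: choice.unpickle => //= s; rewrite /C; case: ifP.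
Qed.

End fell_preimage.

(** * A countable base of open balls and of compact cubes *)

Section rational_balls.
Variables (R : realType) (l : nat).
Local Notation E := 'rV[R]_l.+1.

(** The ball is an open cube, the norm being the sup norm; the closed cube with the same centre and
    radius is its compact counterpart, used for misses. *)
Definition rball (b : bool) (i : 'rV[rat]_l.+1 * nat) : set E :=
  if b then ball (map_mx ratr i.1 : E) i.2.+1%:R^-1
  else [set y : E | forall j,
    `[ratr (i.1 0 j) - i.2.+1%:R^-1, ratr (i.1 0 j) + i.2.+1%:R^-1]%classic
      (y 0 j)].

Lemma rballW i : rball true i `<=` rball false i.
Proof.
move=> y [_ iy] j; have := iy 0 j; rewrite /ball /= mxE in_itv/= ltr_norml.
by move: (ratr _) (_^-1) => a e /andP[? ?]; apply/andP; split; lra.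
Qed.

Lemma rball_open i : open (rball true i).
Proof. exact: ball_open. Qed.

Lemma rball_compact i : compact (rball false i).
Proof.
pose A j : set R :=
  `[ratr (i.1 0 j) - i.2.+1%:R^-1, ratr (i.1 0 j) + i.2.+1%:R^-1]%classic.
by apply: (@rV_compact R _ A) => j; exact: segment_compact.
Qed.

Lemma rball_base (U : set E) x : open U -> U x ->
  exists2 i, rball true i x & rball false i `<=` U.
Proof.
move=> oU Ux; have /nbhs_ballP[e /= e0 xe] : nbhs x U by exact: open_nbhs_nbhs.
(* With radius [r < e / 2] and a rational centre within [r] of [x], the closed cube stays within
   [2 * r < e] of [x]. *)
have /ltr_add_invr[n] : 0 < e / 2 by rewrite divr_gt0.
rewrite add0r => ne.
have n0 : 0 < n.+1%:R^-1 :> R by rewrite invr_gt0.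
move: n0 ne; set r := _^-1 => n0 ne.
have zP j : exists q : rat, x 0 j - r < ratr q < x 0 j + r.
  have [|q] := @rat_in_itvoo R (x 0 j - r) (x 0 j + r).
    by rewrite ltrBlDr -addrA ltrDl addr_gt0.
  by rewrite in_itv/=; exists q.
pose z := \row_j sval (cid (zP j)).
have zE j : x 0 j - r < ratr (z 0 j) < x 0 j + r.
  by rewrite mxE; exact: svalP (cid (zP j)).
exists (z, n).
  split => //= a j; rewrite (ord1 a) /ball /= mxE ltr_norml -/r.
  by move: (zE j); move: (ratr _) => b /andP[? ?]; apply/andP; split; lra.
move=> y iy; apply: xe; split => // a j; rewrite (ord1 a) /ball /= ltr_norml.
have := iy j; rewrite /= in_itv/= -/r; move: (zE j); move: (ratr _) => b.
by move=> /andP[? ?] /andP[? ?]; apply/andP; split; lra.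
Qed.

Lemma rball_base_open (U : set E) x : open U -> U x ->
  exists2 i, rball true i x & rball true i `<=` U.
Proof.
by move=> oU /(rball_base oU)[i ix iU]; exists i => //; exact: subset_trans (@rballW i) iU.
Qed.

Lemma rball_base_nbhs (U : set E) x : open U -> U x ->
  exists2 i, nbhs x (rball false i) & rball false i `<=` U.
Proof.
move=> oU /(rball_base oU)[i ix iU]; exists i => //.
by apply: filterS (@rballW i) _; apply: open_nbhs_nbhs; split => //; exact: rball_open.
Qed.

End rational_balls.
Arguments rball R {l}.

(** * Generators of the sigma-fields of hyperplanes and tessellations *)

Section hyperplane_gen.
Variables (R : realType) (l : nat).
Local Notation E := 'rV[R]_l.+1.
Local Notation H := (hyperplane R l).

Lemma hyperplane_gen (G : set_system H) : sigma_algebra setT G ->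
  (forall i, G [set h | hyperplane_set h `&` rball R true i !=set0]) ->
  forall A : set H, measurable A -> G A.
Proof.
move=> sG Gi _ [B mB <-]; rewrite setTI.
exact: (fell_preimage_gen (@rball_open R l) (@rball_base_open R l) sG Gi).
Qed.

Lemma hyperplane_preimage_open (O : set (fell E)) : open O ->
  measurable [set h : H | O (val h)].
Proof.
by move=> oO; exists O; [exact: sub_sigma_algebra|rewrite setTI].
Qed.

Lemma measurable_hit_open (O : set E) : open O ->
  measurable [set h : H | hyperplane_set h `&` O !=set0].
Proof. by move=> oO; exact: (hyperplane_preimage_open (open_fell_hit oO)). Qed.

Lemma measurable_hitting (K : set E) : compact K -> measurable (@hitting R l K).
Proof.
move=> cK; rewrite -[X in measurable X]setCK; apply: measurableC.
have := hyperplane_preimage_open (open_fell_miss cK).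
congr measurable; apply/seteqP; split => h /=.
  by move=> hK [y yK]; have : set0 y by rewrite -hK.
by move=> hK; rewrite -subset0 => y yK; apply: hK; exists y.
Qed.

Lemma hyperplane_inj (h h' : H) : hyperplane_set h = hyperplane_set h' -> h = h'.
Proof. by move=> hh'; apply: val_inj; exact: fell_inj. Qed.

End hyperplane_gen.

(** * Events that some cell passes finitely many hit and miss conditions *)

Section cell_tests.
Variables (R : realType) (l : nat).
Local Notation E := 'rV[R]_l.+1.

Definition cell_hit (V F : set (set E)) : Prop := exists2 C, F C & V C.

Definition hits_all (s : seq (bool * set E)) : set (set E) :=
  [set C | forall p, p \in s -> hits p.1 p.2 C].

(** At least one open subset of [W] has to be hit: this ensures that a polytope passing the test
    meets [W] in a set with nonempty interior, hence is not lost in the restriction to [W]. *)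
Definition local_test (W : set E) (V : set (set E)) : Prop :=
  exists s : seq (bool * set E), [/\ exists G, (true, G) \in s,
    forall p, p \in s -> p.2 `<=` W /\ (if p.1 then open p.2 else compact p.2) &
    V = hits_all s].

Lemma hits_open b (A : set E) : (if b then open A else compact A) ->
  open [set F : fell E | hits b A F].
Proof. by case: b => hA; [exact: open_fell_hit|exact: open_fell_miss]. Qed.

Lemma hits_all_open (s : seq (bool * set E)) :
  (forall p, p \in s -> if p.1 then open p.2 else compact p.2) ->
  open [set F : fell E | hits_all s F].
Proof.
elim: s => [_|p s IH os].
  by rewrite [X in open X](_ : _ = setT); [exact: openT|apply/seteqP; split].
rewrite [X in open X](_ : _ = [set F : fell E | hits p.1 p.2 F] `&`
    [set F : fell E | hits_all s F]).
  apply: openI; last by apply: IH => q qs; apply: os; rewrite inE qs orbT.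
  by apply: hits_open; apply: os; exact: mem_head.
apply/seteqP; split => F /=.
  move=> Fs; split; first by apply: Fs; exact: mem_head.
  by move=> q qs; apply: Fs; rewrite inE qs orbT.
by move=> [Fp Fs] q; rewrite inE => /orP[/eqP ->//|]; exact: Fs.
Qed.

(** Pulled back to [ne_closed W], [V] is an open set of points, and hitting it is a subbasic
    condition one level up in the iterated hyperspace. *)
Lemma cell_hit_open (W : set E) (V : set (set E)) :
  open [set F : fell E | V F] ->
  open [set T : fell (@ne_closed R l W) |
    cell_hit V [set fell_set (val C) | C in (T : set _)]].
Proof.
move=> oV; pose V' := [set C : ne_closed W | V (fell_set (val C))].
have oV' : open V'.
  apply: (@open_comp _ _ (fun C : ne_closed W => val C) [set F : fell E | V F]) => //.
  by move=> C _; exact: initial_continuous.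
have := open_fell_hit oV'; congr open; apply/seteqP; split => T /=.
  by move=> [C [TC VC]]; exists (fell_set (val C)) => //; exists C.
by move=> [_ [C TC <-] VC]; exists C.
Qed.

Lemma measurable_cell_hit_window (W : window R l) (V : set (set E)) :
  local_test W V -> measurable [set T : window_tess W | cell_hit V (cells T)].
Proof.
move=> [s [_ os ->]].
exists [set T : fell (@ne_closed R l W) |
  cell_hit (hits_all s) [set fell_set (val C) | C in (T : set _)]].
  apply: sub_sigma_algebra; apply: cell_hit_open; apply: hits_all_open => p ps.
  by have [] := os p ps.
by rewrite setTI.
Qed.

Lemma measurable_cell_hit (W : set E) (V : set (set E)) :
  local_test W V -> measurable [set T : tessellation R l | cell_hit V (cells T)].
Proof.
move=> [s [_ os ->]].
exists [set T : fell (@ne_closed R l setT) |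
  cell_hit (hits_all s) [set fell_set (val C) | C in (T : set _)]].
  apply: sub_sigma_algebra; apply: cell_hit_open; apply: hits_all_open => p ps.
  by have [] := os p ps.
by rewrite setTI.
Qed.

Lemma local_testS (W W' : set E) V : W `<=` W' -> local_test W V -> local_test W' V.
Proof.
move=> WW' [s [sG os ->]]; exists s; split => // p ps; have [pW op] := os p ps.
by split => //; exact: subset_trans WW'.
Qed.

(** The separate first index is the ball whose hit [local_test] requires. The index type is
    countable, as [fell_preimage_gen] demands. *)
Definition rtest (i : ('rV[rat]_l.+1 * nat) * seq (bool * ('rV[rat]_l.+1 * nat))) :=
  hits_all [seq (p.1, rball R p.1 p.2) | p <- (true, i.1) :: i.2].

Lemma rtestE i (F : fell E) :
  rtest i F <-> fell_cyl (rball R) ((true, i.1) :: i.2) F.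
Proof.
rewrite /rtest; set s := _ :: _; split => Fs p.
  by move=> ps; apply: (Fs (p.1, rball R p.1 p.2)); apply/mapP; exists p.
by move=> /mapP[q qs ->]; exact: Fs.
Qed.

Lemma rtest_open i : open [set F : fell E | rtest i F].
Proof.
apply: hits_all_open => p /mapP[q _ ->] /=.
by case: q.1; [exact: rball_open|exact: rball_compact].
Qed.

Lemma tessellation_gen (G : set_system (tessellation R l)) : sigma_algebra setT G ->
  (forall i, G [set T | cell_hit (rtest i) (cells T)]) ->
  forall A : set (tessellation R l), measurable A -> G A.
Proof.
move=> sG Gi _ [B mB <-]; rewrite setTI.
pose o i := [set C : @ne_closed R l setT | rtest i (fell_set (val C))].
apply: (@fell_preimage_gen (@ne_closed R l setT) _ o) (sG) _ B mB.
- move=> i; apply: (@open_comp _ _ (fun C : @ne_closed R l setT => val C)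
    [set F : fell E | rtest i F]); last exact: rtest_open.
  by move=> C _; exact: initial_continuous.
- move=> U C [U' oU' <-] /= U'C.
  (* A cell is nonempty, so it hits some rational ball, which can head any cylinder containing the
     cell; thus the sets [rtest i] form a base of [ne_closed]. *)
  have [[x Cx] _] := set_valP C.
  have [i ix _] := rball_base_open (@openT _) (I : setT x).
  have [s Cs sU] := fell_open_cyl (@rball_base_open R l) (@rball_base_nbhs R l) oU' U'C.
  have sE D : fell_cyl (rball R) ((true, i) :: s) D <->
      hits true (rball R true i) D /\ fell_cyl (rball R) s D.
    split.
      move=> Ds; split; first exact: (Ds (true, i) (mem_head _ _)).
      by move=> p ps; apply: Ds; rewrite inE ps orbT.
    by move=> [Di Ds] p; rewrite inE => /orP[/eqP ->//|]; exact: Ds.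
  exists (i, s).
    by apply/rtestE/sE; split => //; exists x.
  by move=> D /rtestE/sE[_ /sU].
- move=> i; have := Gi i; congr G; apply/seteqP; split => T /=.
    by move=> [_ [C TC <-] VC]; exists C.
  by move=> [C [TC VC]]; exists (fell_set (val C)) => //; exists C.
Qed.

End cell_tests.
Arguments rtest R {l}.

(** * Restriction to a window and dilations *)

Section restriction.
Variables (R : realType) (l : nat).
Local Notation E := 'rV[R]_l.+1.

Lemma conv_hull_convex n (p : 'I_n -> E) x y (t : R) : 0 <= t <= 1 ->
  conv_hull p x -> conv_hull p y -> conv_hull p ((1 - t) *: x + t *: y).
Proof.
move=> /andP[t0 t1] [v [v0 v1 ->]] [w [w0 w1 ->]].
exists (fun i => (1 - t) * v i + t * w i); split.
- by move=> i; rewrite addr_ge0 ?mulr_ge0 ?subr_ge0.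
- by rewrite big_split /= -!mulr_sumr v1 w1 !mulr1 subrK.
- rewrite !scaler_sumr -big_split; apply: eq_bigr => i _ /=.
  by rewrite !scalerA scalerDl.
Qed.

(** Moving from [x] slightly towards an interior point [y] stays in [O]. The new point is interior
    to [C], since the homothety [f] centred at [x] takes it to [y], and any [z] with [f z] in [C] is
    a convex combination of [x] and [f z]. *)
Lemma polytope_interior_dense (C O : set E) : polytope C -> open O ->
  C `&` O !=set0 -> C° `&` O !=set0.
Proof.
move=> [[n [p Cp]] [y Cy]] oO [x [Cx Ox]].
have cvx : (fun t : R => (1 - t) *: x + t *: y) @ 0^'+ --> x.
  rewrite -[X in _ --> X]addr0 -[in X in _ --> X](scale1r x).
  rewrite -[in X in _ --> X](scale0r y) -[in X in _ --> X](subr0 1).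
  apply: cvg_at_right_filter; apply: cvgD; apply: cvgZr_tmp; last exact: cvg_id.
  by apply: cvgB; [exact: cvg_cst|exact: cvg_id].
have nO : nbhs x O by exact: open_nbhs_nbhs.
have : \forall t \near (0 : R)^'+, [/\ O ((1 - t) *: x + t *: y), 0 < t & t <= 1].
  near=> t; split; [|by near: t; exact: nbhs_right_gt|].
  - by near: t; exact: cvx.
  - by near: t; apply: nbhs_right_le; exact: ltr01.
move=> /filter_ex[t [Ot t0 t1]]; exists ((1 - t) *: x + t *: y); split => //.
have t0' : t != 0 by rewrite gt_eqF.
pose f (z : E) := t^-1 *: (z - (1 - t) *: x); set z0 := _ + _.
have fy : f z0 = y by rewrite /f /z0 addrC addKr scalerA mulVf// scale1r.
have cf : f z @[z --> z0] --> f z0.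
  apply: (@cvgZ _ _ _ (nbhs z0) _ (fun=> t^-1) (fun z : E => z - (1 - t) *: x)).
    exact: cvg_cst.
  by apply: (@cvgB _ _ _ (nbhs z0) _ id (fun=> (1 - t) *: x) z0 ((1 - t) *: x));
    [exact: cvg_id|exact: cvg_cst].
have nC : nbhs z0 (f @^-1` C) by apply: cf; rewrite fy.
suff fC : f @^-1` C `<=` C by exact: (filterS fC nC).
move=> z /=; rewrite Cp => zC.
have -> : z = (1 - t) *: x + t *: f z.
  by rewrite /f scalerA divff// scale1r addrC subrK.
by apply: conv_hull_convex => //; rewrite ?(ltW t0) ?t1// -Cp.
Unshelve. all: end_near. Qed.

(** Test sets inside [W] do not distinguish a cell from its part in [W]. By density of the interior,
    hitting the open set [G] inside [W] gives this part an interior point, so that it is kept. *)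
Lemma cell_hit_restrict (W : set E) (V F : set (set E)) : F `<=` @polytope R l ->
  local_test W V -> cell_hit V (tess_restrict W F) <-> cell_hit V F.
Proof.
move=> pF [s [[G sG] os ->]]; split.
  move=> [_ [C [FC _] <-] CW]; exists C => // p ps; have := CW p ps.
  have [] := os p ps; case: p {ps} => -[] A /= AW _.
    by move=> [x [[Cx _] Ax]]; exists x.
  by rewrite /hits /= -setIA (setIidr AW).
move=> [C FC sC].
have CW : (C `&` W)° !=set0.
  have [/= GW oG] := os _ sG.
  have [x [Cx Gx]] := polytope_interior_dense (pF _ FC) oG (sC _ sG).
  exists x; rewrite interiorI; split => //.
  have nG : nbhs x G by exact: open_nbhs_nbhs.
  exact: (filterS GW nG).
exists (C `&` W); first by exists C.
move=> p ps; have := sC p ps; have [] := os p ps; case: p {ps} => -[] A /= AW _.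
  by move=> [x [Cx Ax]]; exists x; split => //; split => //; exact: AW.
by rewrite /hits /= -setIA (setIidr AW).
Qed.

Definition vdilate (c : R) (V : set (set E)) : set (set E) :=
  [set C | V (dilate c C)].

Lemma dilateI (c : R) (A B : set E) : c != 0 ->
  dilate c (A `&` B) = dilate c A `&` dilate c B.
Proof. by move=> c0; rewrite !dilateE. Qed.

Lemma dilate_neq0 (c : R) (A : set E) : dilate c A !=set0 <-> A !=set0.
Proof.
by split => [[_ [x Ax _]]|[x Ax]]; [exists x|exists (c *: x); exists x].
Qed.

Lemma dilate_eq0 (c : R) (A : set E) : dilate c A = set0 <-> A = set0.
Proof.
split=> [cA|->]; last by rewrite /dilate image_set0.
by apply: contrapT => /eqP/set0P/(dilate_neq0 c)/set0P/eqP.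
Qed.

Lemma dilate_compact (c : R) (A : set E) : compact A -> compact (dilate c A).
Proof.
move=> cA; apply: continuous_compact => //; apply: continuous_subspaceT.
exact: scaler_cont.
Qed.

Lemma dilate_open (c : R) (A : set E) : c != 0 -> open A -> open (dilate c A).
Proof.
move=> c0 oA; rewrite dilateE//; apply: open_comp => // x _; exact: scaler_cont.
Qed.

Lemma dilateVK (c : R) : c != 0 -> cancel (@dilate R l c^-1) (dilate c).
Proof. move=> c0 A; have c0' : c^-1 != 0 by rewrite invr_eq0.
by have := dilateK c0' A; rewrite invrK. Qed.

Lemma local_test_dilate (W : set E) V (c : R) : c != 0 -> local_test W V ->
  local_test (dilate c^-1 W) (vdilate c V).
Proof.
move=> c0 [s [[G sG] os ->]]; have c0' : c^-1 != 0 by rewrite invr_eq0.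
exists [seq (p.1, dilate c^-1 p.2) | p <- s]; split.
- by exists (dilate c^-1 G); apply/mapP; exists (true, G).
- move=> _ /mapP[p ps ->] /=; have [pW op] := os p ps; split.
    exact: image_subset.
  by case: p.1 op => ?; [exact: dilate_open|exact: dilate_compact].
have hE b (A C : set E) : hits b A (dilate c C) <-> hits b (dilate c^-1 A) C.
  rewrite -[in X in X <-> _](dilateVK c0 A) /hits.
  by case: b => /=; rewrite -dilateI//; [exact: dilate_neq0|exact: dilate_eq0].
apply/seteqP; split => C Cs p.
  by move=> /mapP[q qs ->]; apply/hE; exact: Cs.
by move=> ps; apply/hE; apply: (Cs (p.1, _)); apply/mapP; exists p.
Qed.

Lemma cell_hit_tdilate (c : R) (c0 : c != 0) V (T : tess setT) :
  cell_hit V (cells (tdilate c0 T)) <-> cell_hit (vdilate c V) (cells T).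
Proof.
rewrite cells_tdilate; split => [[_ [C TC <-] VC]|[C TC VC]]; first by exists C.
by exists (dilate c C) => //; exists C.
Qed.

Lemma tdilateK (c d : R) (c0 : c != 0) (d0 : d != 0) : d * c = 1 ->
  cancel (@tdilate R l c c0) (tdilate d0).
Proof.
move=> dc T; apply: cells_inj; rewrite !cells_tdilate image_comp.
have -> : d = c^-1 by rewrite -[LHS](mulfK c0) dc mul1r.
rewrite (_ : dilate c^-1 \o dilate c = id) ?image_id//.
by apply/funext => A /=; rewrite dilateK.
Qed.

Lemma measurable_tdilate (c : R) (c0 : c != 0) :
  measurable_fun setT (tdilate c0 : tessellation R l -> tessellation R l).
Proof.
move=> _ A mA; rewrite setTI.
pose G : set_system (tessellation R l) :=
  [set A | measurable ((tdilate c0 : tessellation R l -> tessellation R l) @^-1` A)].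
suff : G A by [].
apply: tessellation_gen mA.
  by apply: sigma_algebra_preimageT; exact: sigma_algebra_measurable.
move=> i; rewrite /G /=.
have tW : local_test setT (rtest R i).
  exists [seq (p.1, rball R p.1 p.2) | p <- (true, i.1) :: i.2]; split => //.
    by exists (rball R true i.1); exact: mem_head.
  move=> p /mapP[q _ ->]; split => //=.
  by case: q.1; [exact: rball_open|exact: rball_compact].
have := measurable_cell_hit (local_test_dilate c0 tW).
rewrite [X in measurable X -> _](_ : _ = tdilate c0 @^-1`
  [set T | cell_hit (rtest R i) (cells T)])//.
by apply/seteqP; split => T; have := cell_hit_tdilate c0 (rtest R i) T => -[].
Qed.

Lemma compact_window (K : set E) : compact K -> exists W : window R l, K `<=` W.
Proof.
move=> /compact_bounded[M [_ KM]].
pose N : R := `|M| + 1; have N0 : 0 < N by rewrite ltr_pwDr.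
(* The vertices of the cube with coordinates in [[- N, N]], as affine images of those of the unit
   cube at [0], so that [unit_cube_hull] applies. *)
pose q (j : 'I_#|{: {ffun 'I_l.+1 -> bool}}|) : E := (2 * N) *:
  \row_i ((((0 : 'rV[int]_l.+1) 0 i)%:~R + (enum_val j i)%:R) : R) - const_mx N.
have qN (x : E) : (forall i, `|x 0 i| <= N) -> conv_hull q x.
  move=> xN.
  have : @unit_cube R l 0 ((2 * N)^-1 *: (x + const_mx N)).
    move=> i; rewrite !mxE add0r.
    have := xN i; rewrite ler_norml => /andP[x1 x2].
    have N2 : 0 < 2 * N by rewrite mulr_gt0.
    rewrite mulr_ge0 ?invr_ge0 ?(ltW N2)//=; last by rewrite -lerBlDr sub0r.
    rewrite mulrC ler_pdivrMr// mul1r; lra.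
  rewrite unit_cube_hull => -[w [w0 w1 xE]]; exists w; split => //.
  have -> : x = (2 * N) *: ((2 * N)^-1 *: (x + const_mx N)) - const_mx N.
    by rewrite scalerA divff ?scale1r ?addrK// mulf_neq0// gt_eqF.
  rewrite xE scaler_sumr.
  have {1}-> : const_mx N = \sum_i w i *: const_mx N :> E.
    by rewrite -scaler_suml w1 scale1r.
  rewrite -sumrB; apply: eq_bigr => j _.
  by rewrite /q scalerBr !scalerA mulrC.
have pq : polytope (conv_hull q).
  split; first by exists _, q.
  exists 0; apply/nbhs_ballP; exists N => //= x [_ xN]; apply: qN => i.
  by have := xN 0 i; rewrite /ball /= mxE sub0r normrN => /ltW.
exists (Window pq) => x Kx /=; apply: qN => i.
have xN : `|x| <= N.
  by apply: KM Kx; rewrite (le_lt_trans (ler_norm M))// ltrDl.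
apply: le_trans xN.
have /mapP[j Hj ->] : `|x 0 i| \in [seq `|x y.1 y.2| | y : 'I_1 * 'I_l.+1].
  by apply/mapP; exists (0, i) => //=; rewrite mem_enum.
rewrite [leRHS]/Num.Def.normr /= mx_normrE.
by apply/bigmax_geP; right => /=; exists j.
Qed.

Lemma rtest_local i : exists2 K : set E, compact K & local_test K (rtest R i).
Proof.
pose s := [seq (p.1, rball R p.1 p.2) | p <- (true, i.1) :: i.2].
pose K := \big[setU/set0]_(p <- (true, i.1) :: i.2) rball R (l := l) false p.2.
exists K.
  rewrite /K; elim/big_ind : _ => [|A B|p _]; first exact: compact0.
    exact: compactU.
  exact: rball_compact.
exists s; split => //.
  by exists (rball R true i.1); exact: mem_head.
move=> _ /mapP[q qs ->]; split => /=; last first.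
  by case: q.1; [exact: rball_open|exact: rball_compact].
rewrite /K; elim: (_ :: _) qs => // p t IH; rewrite inE big_cons => /orP[/eqP <-|qt].
  by move=> x qx; left; case: q.1 qx => // /rballW.
by move=> x /(IH qt); right.
Qed.

End restriction.

(** * Coordinates of hyperplanes *)

Section hyperplane_coordinates.
Variables (R : realType) (l : nat).
Local Notation E := 'rV[R]_l.+1.
Local Notation H := (hyperplane R l).
Local Notation "''e_' i" := (delta_mx 0 i : E) (at level 8, i at level 2).

Lemma dotDr (u x y : E) : dot u (x + y) = dot u x + dot u y.
Proof. by rewrite -big_split; apply: eq_bigr => i _; rewrite mxE mulrDr. Qed.

Lemma dotZr (u x : E) c : dot u (c *: x) = c * dot u x.
Proof. by rewrite mulr_sumr; apply: eq_bigr => i _; rewrite mxE mulrCA. Qed.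

Lemma dot_delta (u : E) i : dot u 'e_i = u 0 i.
Proof.
rewrite /dot (bigD1 i)//= mxE !eqxx mulr1 big1 ?addr0// => j ji.
by rewrite mxE eqxx (negbTE ji) mulr0.
Qed.

Lemma dot0r (u : E) : dot u 0 = 0.
Proof. by rewrite -(scale0r 0) dotZr mul0r. Qed.

Lemma hyperplaneP (h : H) :
  exists p : E * R, p.1 != 0 /\ hyperplane_set h = [set x | dot p.1 x = p.2].
Proof. by have [u [r ur]] := set_valP h; exists (u, r). Qed.

(** Normal vector and offset are picked by choice, without normalisation; [transversal] and
    [intercept] do not change when both are rescaled. *)
Definition normal (h : H) : E := (sval (cid (hyperplaneP h))).1.
Definition offset (h : H) : R := (sval (cid (hyperplaneP h))).2.

Lemma normal_neq0 h : normal h != 0.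
Proof. by rewrite /normal; case: cid => p []. Qed.

Lemma hyperplaneE h x : hyperplane_set h x <-> dot (normal h) x = offset h.
Proof.
have [_ hE] := svalP (cid (hyperplaneP h)).
by rewrite [in X in X <-> _]hE.
Qed.

Lemma hyperplane_exists (u : E) (r : R) : u != 0 ->
  exists h : H, hyperplane_set h = [set x | dot u x = r].
Proof.
move=> u0.
have uH : @hyperplane_space R l (Fell (@hyperplane_closed R l u r)) by exists u, r.
by exists (SigSub (mem_set uH)).
Qed.

Definition transversal i : set H := [set h | normal h 0 i != 0].

(* The [s] for which [h] contains [y + s *: 'e_i]; if [h] is not transversal to
   ['e_i] this is a division by zero, with value [0]. *)
Definition intercept i (y : E) (h : H) : R :=
  (offset h - dot (normal h) y) / normal h 0 i.

Lemma interceptP i y h s : transversal i h ->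
  hyperplane_set h (y + s *: 'e_i) <-> s = intercept i y h.
Proof.
move=> ti; rewrite hyperplaneE dotDr dotZr dot_delta /intercept; split => [<-|->].
  by rewrite addrC addKr mulfK.
by rewrite divfK// addrC subrK.
Qed.

(** This form does not mention the chosen normal vector, and so passes to translates. *)
Lemma transversalP i h : transversal i h <->
  exists (y : E) (s : R), hyperplane_set h y /\ ~ hyperplane_set h (y + s *: 'e_i).
Proof.
split => [ti|[y [s [/hyperplaneE hy]]]]; last first.
  move=> nh; apply/negP => /eqP ni; apply: nh; apply/hyperplaneE.
  by rewrite dotDr dotZr dot_delta ni mulr0 addr0.
exists (0 + intercept i 0 h *: 'e_i), 1; split; first exact/interceptP.
rewrite -addrA -scalerDl => /(interceptP _ _ ti)/eqP.
by rewrite -subr_eq0 addrC addKr oner_eq0.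
Qed.

Lemma transversal_cover h : exists i, transversal i h.
Proof.
apply: contrapT => nt; have /eqP := normal_neq0 h; apply; apply/rowP => i.
by rewrite mxE; apply/eqP/negPn/negP => hi; apply: nt; exists i.
Qed.

Lemma not_transversal i y h : ~ transversal i h -> intercept i y h = 0.
Proof. by move=> /negP; rewrite negbK /intercept => /eqP ->; rewrite invr0 mulr0. Qed.

Definition segment i (y : E) (p q : R) : set E :=
  [set y + s *: 'e_i | s in `[p, q]].

Lemma segment_line_compact i y p q : compact (segment i y p q).
Proof.
apply: continuous_compact; last exact: segment_compact.
apply: continuous_subspaceT => s; apply: (@cvgD _ _ _ (nbhs s) _ (fun=> y)
  (fun s : R => s *: 'e_i)); first exact: cvg_cst.
by apply: (@cvgZr_tmp _ _ _ (nbhs s) _ id); exact: cvg_id.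
Qed.

Lemma hitting_segment i y p q h : transversal i h ->
  hitting (segment i y p q) h <-> p <= intercept i y h <= q.
Proof.
move=> ti; split.
  move=> [x [hx [s spq sx]]]; move: hx spq.
  by rewrite -sx /= in_itv/= => /(interceptP _ _ ti) <-.
move=> pq; exists (y + intercept i y h *: 'e_i); split; first exact/interceptP.
by exists (intercept i y h).
Qed.

Lemma measurable_transversal i : measurable (transversal i).
Proof.
(* A hyperplane is transversal to an axis when it meets the axis without containing it, that is,
   without containing both [0] and ['e_i]. *)
rewrite [X in measurable X](_ : _ =
  (\bigcup_n hitting (segment i 0 (- n%:R) n%:R)) `&`
  ~` (hitting [set (0 : E)] `&` hitting [set 'e_i])).
  apply: measurableI.
    by apply: bigcup_measurable => n _; apply/measurable_hitting/segment_line_compact.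
  apply: measurableC; apply: measurableI; apply: measurable_hitting;
    exact: compact_set1.
have h1 (x : E) (h : H) : hitting [set x] h <-> hyperplane_set h x.
  by split=> [[y [hy yx]]|hx]; [rewrite -yx|exists x].
apply/seteqP; split => h.
  move=> ti; split.
    exists (Num.Def.trunc `|intercept i 0 h|).+1 => //; apply/hitting_segment => //.
    by rewrite -ler_norml ltW// truncnS_gt.
  move=> [/h1 h0 /h1 he].
  have i0 : 0 = intercept i 0 h.
    by apply/(interceptP _ _ ti); rewrite scale0r addr0.
  have : 1 = intercept i 0 h.
    by apply/(interceptP _ _ ti); rewrite scale1r add0r.
  by rewrite -i0 => /eqP; rewrite oner_eq0.
move=> [[n _ [x [hx [s _ sx]]]] nh]; apply/negP => /eqP ni.
move: hx => /hyperplaneE; rewrite -sx dotDr dotZr dot_delta ni mulr0 addr0.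
move=> h0; apply: nh; split; apply/h1/hyperplaneE => //.
by rewrite dot_delta ni -h0 dot0r.
Qed.

Lemma measurable_intercept i y : measurable_fun setT (intercept i y).
Proof.
have mt := measurable_transversal i.
rewrite -(setvU (transversal i)) setUC; apply/measurable_funU => //.
  exact: measurableC.
split; last first.
  have := @eq_measurable_fun _ _ H R (~` transversal i) (cst 0) (intercept i y).
  apply; last exact: measurable_cst.
  by move=> h; rewrite inE => /not_transversal ->.
apply: (measurability _ (@RGenCInfty.measurableE R)) => _ [_ [a ->] <-].
(* The intercept is at least [a] when some compact segment of the line starting at parameter [a] is
   hit. *)
rewrite [X in measurable X](_ : _ = transversal i `&`
    \bigcup_n hitting (segment i y a (a + n%:R))).
  apply: measurableI => //; apply: bigcup_measurable => n _.
  exact/measurable_hitting/segment_line_compact.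
apply/seteqP; split => h [ti]; last first.
  move=> [n _ /(hitting_segment _ _ _ ti)/andP[ah _]]; split => //=.
  by rewrite in_itv/= ah.
rewrite /= in_itv/= andbT => ah; split => //.
exists (Num.Def.trunc `|intercept i y h - a|).+1 => //; apply/hitting_segment => //.
rewrite ah -lerBlDl; apply: le_trans (ler_norm _) _.
by rewrite ltW// truncnS_gt.
Qed.

Definition htranslate (x : E) (h : H) : H :=
  xget h [set h' | hyperplane_set h' = [set x + y | y in hyperplane_set h]].

Lemma htranslateE x h :
  hyperplane_set (htranslate x h) = [set x + y | y in hyperplane_set h].
Proof.
apply: (@xgetPex _ h [set h' | hyperplane_set h' = [set x + y | y in hyperplane_set h]]).
have [h' hh'] := hyperplane_exists (offset h + dot (normal h) x) (normal_neq0 h).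
exists h' => /=; rewrite hh'; apply/seteqP; split => z /=.
  move=> hz; exists (z - x); last by rewrite addrC subrK.
  apply/hyperplaneE/(addIr (dot (normal h) x)).
  by rewrite -dotDr subrK.
by move=> [y /hyperplaneE hy <-]; rewrite dotDr hy addrC.
Qed.

Lemma htranslateP x h z : hyperplane_set (htranslate x h) z <-> hyperplane_set h (z - x).
Proof.
rewrite htranslateE; split => [[y hy <-]|hz]; first by rewrite addrC addKr.
by exists (z - x) => //; rewrite addrC subrK.
Qed.

Definition hdilate (c : R) (h : H) : H :=
  xget h [set h' | hyperplane_set h' = dilate c (hyperplane_set h)].

Lemma hdilateE c h : c != 0 ->
  hyperplane_set (hdilate c h) = dilate c (hyperplane_set h).
Proof.
move=> c0.
apply: (@xgetPex _ h [set h' | hyperplane_set h' = dilate c (hyperplane_set h)]).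
have [h' hh'] := hyperplane_exists (c * offset h) (normal_neq0 h).
exists h' => /=; rewrite hh' dilateE//; apply/seteqP; split => z /=.
  by move=> hz; apply/hyperplaneE; rewrite dotZr hz mulKf.
by move=> /hyperplaneE <-; rewrite dotZr mulVKf.
Qed.

Lemma hdilateK (c : R) : c != 0 -> cancel (hdilate c) (hdilate c^-1).
Proof.
move=> c0 h; apply: hyperplane_inj.
by rewrite !hdilateE ?invr_eq0// dilateK.
Qed.

Lemma hdilateVK (c : R) : c != 0 -> cancel (hdilate c^-1) (hdilate c).
Proof.
by move=> c0 h; apply: hyperplane_inj; rewrite !hdilateE ?invr_eq0// dilateVK.
Qed.

Lemma hdilate_hit (c : R) (A : set E) h : c != 0 ->
  hyperplane_set (hdilate c h) `&` A !=set0 <->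
  hyperplane_set h `&` dilate c^-1 A !=set0.
Proof.
move=> c0; rewrite hdilateE// -[in X in X <-> _](dilateVK c0 A) -dilateI//.
exact: dilate_neq0.
Qed.

Lemma measurable_hdilate (c : R) : c != 0 -> measurable_fun setT (hdilate c).
Proof.
move=> c0 _ A mA; rewrite setTI.
pose G : set_system H := [set A | measurable (hdilate c @^-1` A)].
suff : G A by [].
apply: hyperplane_gen mA.
  by apply: sigma_algebra_preimageT; exact: sigma_algebra_measurable.
move=> i; rewrite /G /=.
have c0' : c^-1 != 0 by rewrite invr_eq0.
have := measurable_hit_open (dilate_open c0' (@rball_open R l i)).
rewrite [X in measurable X -> _](_ : _ = hdilate c @^-1`
   [set h | hyperplane_set h `&` rball R true i !=set0])//.
by apply/seteqP; split => h; have := hdilate_hit (rball R true i) h c0 => -[].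
Qed.

Lemma transversal_htranslate i t y h : transversal i h ->
  transversal i (htranslate (t *: 'e_i) h) /\
  intercept i y (htranslate (t *: 'e_i) h) = intercept i y h + t.
Proof.
move=> ti; have ti' : transversal i (htranslate (t *: 'e_i) h).
  have /transversalP[z [s [hz hzs]]] := ti.
  apply/transversalP; exists (z + t *: 'e_i), s.
  by rewrite !htranslateP addrK addrAC addrK.
split => //; apply/esym/interceptP => //; apply/htranslateP.
by rewrite scalerDl addrA addrK; exact/interceptP.
Qed.

(* On hyperplanes transversal to a line through the origin, dilating amounts
   to translating along that line. *)
Lemma hdilate_htranslate i c h : c != 0 -> transversal i h ->
  hdilate c h = htranslate (((c - 1) * intercept i 0 h) *: 'e_i) h.
Proof.
move=> c0 ti; apply: hyperplane_inj; rewrite hdilateE// dilateE//.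
have zE z : dot (normal h) (z - (c - 1) * intercept i 0 h *: 'e_i) =
    dot (normal h) z - (c - 1) * offset h.
  rewrite dotDr -scaleNr dotZr dot_delta /intercept dot0r subr0.
  by rewrite mulNr -mulrA divfK.
apply/seteqP; split => z; last move=> /htranslateP.
  move=> /= /hyperplaneE hz; apply/htranslateP/hyperplaneE; move: hz.
  rewrite zE dotZr => /(canRL (mulVKf c0)) ->; ring.
move=> /hyperplaneE; rewrite zE => hz; apply/hyperplaneE; rewrite dotZr.
by apply: (mulfI c0); rewrite mulVKf// -[LHS](subrK ((c - 1) * offset h)) hz; ring.
Qed.

End hyperplane_coordinates.

(** * Homogeneity of the driving measure *)

(** Cauchy's functional equation for a monotone function: enclosing [n * c] between consecutive
    integers bounds [n] times the defect of linearity by [f t], for every [n]. *)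
Lemma additive_ge0_linear (R : realType) (f : R -> R) :
  (forall s t, 0 <= s -> 0 <= t -> f (s + t) = f s + f t) ->
  (forall t, 0 <= t -> 0 <= f t) ->
  forall c t, 0 <= c -> 0 <= t -> f (c * t) = c * f t.
Proof.
move=> fD f0 c t c0 t0.
have fM n s : 0 <= s -> f (n%:R * s) = n%:R * f s.
  move=> s0; elim: n => [|n IH].
    by rewrite !mul0r; have := fD 0 0 (lexx _) (lexx _); rewrite addr0; lra.
  by rewrite -natr1 !mulrDl !mul1r fD ?mulr_ge0// IH.
have fle s u : 0 <= s -> s <= u -> f s <= f u.
  move=> s0 su; rewrite -[u](subrK s) addrC fD ?subr_ge0// lerDl f0//.
  by rewrite subr_ge0.
have ct0 : 0 <= c * t by rewrite mulr_ge0.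
have bound n : n%:R * `|f (c * t) - c * f t| <= f t.
  pose k := Num.trunc (n%:R * c).
  have nc0 : 0 <= n%:R * c by rewrite mulr_ge0.
  have k1 : k%:R <= n%:R * c by rewrite Num.Theory.truncn_le.
  have k2 : n%:R * c < k.+1%:R by exact: truncnS_gt.
  have h1 : k%:R * f t <= n%:R * f (c * t).
    rewrite -!fM//; apply: fle; first by rewrite mulr_ge0.
    by rewrite mulrA ler_wpM2r.
  have h2 : n%:R * f (c * t) <= k.+1%:R * f t.
    rewrite -!fM//; apply: fle; first by rewrite mulr_ge0.
    by rewrite mulrA ler_wpM2r// ltW.
  have h3 : k%:R * f t <= n%:R * c * f t by rewrite ler_wpM2r// f0.
  have h4 : n%:R * c * f t <= k.+1%:R * f t by rewrite ler_wpM2r ?f0// ltW.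
  rewrite -[X in X * _](ger0_norm (ler0n _ n)) -normrM ler_norml.
  by move: h2 h4; rewrite -natr1 mulrDl mul1r mulrBr mulrA => h2 h4; apply/andP; split; lra.
apply/eqP; rewrite -subr_eq0 -normr_eq0; apply/eqP/le_anti; rewrite normr_ge0 andbT.
rewrite leNgt; apply/negP => d0.
have := truncnS_gt (f t / `|f (c * t) - c * f t|); rewrite ltr_pdivrMr//.
by rewrite ltNge bound.
Qed.

Section driving_scaling.
Variables (R : realType) (l : nat).
Local Notation E := 'rV[R]_l.+1.
Local Notation H := (hyperplane R l).
Local Notation "''e_' i" := (delta_mx 0 i : E) (at level 8, i at level 2).

(** Half-open, so that adjacent slabs are disjoint and join into a slab. *)
Definition slab i (p q : R) : set H := [set h | p <= intercept i 0 h < q].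

Lemma measurable_slab i p q : measurable (slab i p q).
Proof.
rewrite (_ : slab i p q = setT `&` intercept i 0 @^-1` `[p, q[%classic).
  by apply: measurable_intercept => //; exact: measurable_itv.
by rewrite setTI; apply/seteqP; split => h; rewrite /slab /= in_itv.
Qed.

(** Among the hyperplanes transversal to ['e_i], translations along ['e_i] reach all parallel ones,
    so an invariant set is a condition on the direction alone. *)
Definition line_invariant i (B : set H) :=
  forall t h, B h -> B (htranslate (t *: 'e_i) h).

Definition slab_sets i : set_system H :=
  [set A | exists (B : set H) p q, [/\ measurable B, line_invariant i B &
     A = B `&` slab i p q]].

Lemma slab_sets_measurable i : slab_sets i `<=` measurable.
Proof.
by move=> _ [B [p [q [mB _ ->]]]]; apply: measurableI => //; exact: measurable_slab.
Qed.

Lemma slab_setI i p q p' q' :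
  slab i p q `&` slab i p' q' = slab i (Num.max p p') (Num.min q q').
Proof.
apply/seteqP; split => h; rewrite /slab /= ge_max lt_min.
  by move=> [/andP[-> ->] /andP[-> ->]].
by move=> /andP[/andP[-> ->] /andP[-> ->]].
Qed.

Lemma slab_sets_setI i : setI_closed (slab_sets i).
Proof.
move=> _ _ [B [p [q [mB iB ->]]]] [B' [p' [q' [mB' iB' ->]]]].
exists (B `&` B'), (Num.max p p'), (Num.min q q'); split.
- exact: measurableI.
- by move=> t h [Bh B'h]; split; [exact: iB|exact: iB'].
- by rewrite -slab_setI setIACA.
Qed.

Lemma htranslateNK x : cancel (@htranslate R l x) (htranslate (- x)).
Proof.
move=> h; apply: hyperplane_inj; apply/seteqP; split => z.
  by move=> /htranslateP/htranslateP; rewrite opprK addrK.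
by move=> hz; apply/htranslateP/htranslateP; rewrite opprK addrK.
Qed.

Lemma htranslateVK x : cancel (htranslate (- x)) (@htranslate R l x).
Proof. by move=> h; have := htranslateNK (- x) h; rewrite opprK. Qed.

Lemma transversal_invariant i : line_invariant i (@transversal R l i).
Proof. by move=> t h /(transversal_htranslate t 0)[]. Qed.

Lemma translate_slab i (B : set H) p q t : B `<=` transversal i ->
  line_invariant i B ->
  translate (t *: 'e_i) (B `&` slab i p q) = B `&` slab i (p + t) (q + t).
Proof.
move=> Bt iB; apply/seteqP; split => h; rewrite /slab /=.
  move=> [h' [Bh' pq]]; rewrite -htranslateE => /hyperplane_inj ->.
  have [_ ->] := transversal_htranslate t 0 (Bt _ Bh').
  by split; [exact: iB|rewrite lerD2r ltrD2r].
move=> [Bh pq]; exists (htranslate (- (t *: 'e_i)) h); last first.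
  by rewrite -htranslateE htranslateVK.
rewrite -scaleNr /=; have [_ ->] := transversal_htranslate (- t) 0 (Bt _ Bh).
by split; [exact: iB|rewrite lerBrDr ltrBlDr].
Qed.

(** By [hdilate_htranslate] a dilation moves a transversal hyperplane along ['e_i], hence preserves
    [B], while it multiplies the intercept by [c]. *)
Lemma hdilate_slab i (B : set H) p q c : 0 < c -> B `<=` transversal i ->
  line_invariant i B ->
  hdilate c @^-1` (B `&` slab i (c * p) (c * q)) = B `&` slab i p q.
Proof.
move=> c0 Bt iB; have c0' : c != 0 by rewrite gt_eqF.
have dB d h : d != 0 -> B h -> B (hdilate d h).
  by move=> d0 Bh; rewrite (hdilate_htranslate d0 (Bt _ Bh)); exact: iB.
have BE h : B (hdilate c h) <-> B h.
  split=> [Bh|]; last exact: dB.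
  by rewrite -(hdilateK c0' h); apply: dB => //; rewrite invr_eq0.
have dE h : transversal i h -> intercept i 0 (hdilate c h) = c * intercept i 0 h.
  move=> th; rewrite (hdilate_htranslate c0' th).
  have [_ ->] := transversal_htranslate ((c - 1) * intercept i 0 h) 0 th.
  by ring.
apply/seteqP; split => h; rewrite /slab /= => -[Bh].
  by have /BE Bh' := Bh; rewrite (dE _ (Bt _ Bh')) ler_pM2l// ltr_pM2l.
by rewrite (dE _ (Bt _ Bh)) ler_pM2l// ltr_pM2l//; split => //; exact/BE.
Qed.

Variable Lambda : {measure set H -> \bar R}.
Hypothesis hLambda : driving_measure Lambda.

Lemma slab_finite i p q : (Lambda (transversal i `&` slab i p q) < +oo)%E.
Proof.
have [_ _ _ fin _] := hLambda.
have [W sW] := compact_window (@segment_line_compact R l i 0 p q).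
apply: le_lt_trans (fin W); apply: le_measure.
- rewrite inE; apply: measurableI; first exact: measurable_transversal.
  exact: measurable_slab.
- by rewrite inE; apply: measurable_hitting; exact/polytope_compact/window_polytope.
move=> h [th /andP[ph hq]].
have /(hitting_segment 0 p q th)[x [hx sx]] : p <= intercept i 0 h <= q.
  by rewrite ph ltW.
by exists x; split => //; exact: sW.
Qed.

(** Translation invariance along ['e_i] makes the measure a function [f] of [q - p] only. Cutting a
    slab in two shows that [f] is additive, hence linear. *)
Lemma driving_slab_scaling i (B : set H) p q c : 0 < c -> measurable B ->
  B `<=` transversal i -> line_invariant i B ->
  Lambda (B `&` slab i (c * p) (c * q)) = (c%:E * Lambda (B `&` slab i p q))%E.
Proof.
move=> c0 mB Bt iB; have [_ _ trans _ _] := hLambda.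
pose F p q := Lambda (B `&` slab i p q).
have mF p' q' : measurable (B `&` slab i p' q').
  by apply: measurableI => //; exact: measurable_slab.
have finF p' q' : F p' q' \is a fin_num.
  rewrite ge0_fin_numE//; apply: le_lt_trans (slab_finite i p' q').
  apply: le_measure; rewrite ?inE//; last exact: setSI.
  by apply: measurableI; [exact: measurable_transversal|exact: measurable_slab].
have [qp|pq] := leP q p.
  have s0 p' q' : q' <= p' -> slab i p' q' = set0.
    move=> qp'; rewrite -subset0 => h /andP[ph hq].
    by have := le_lt_trans ph hq; rewrite ltNge qp'.
  by rewrite !s0// ?setI0 ?measure0 ?mule0// ler_pM2l.
have shift p' q' t : F (p' + t) (q' + t) = F p' q'.
  by rewrite /F -translate_slab// trans.
pose f t := fine (F 0 t).
have fF p' q' : F p' q' = (f (q' - p'))%:E.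
  by rewrite /f fineK// -(shift 0 (q' - p') p') add0r subrK.
rewrite -/(F _ _) -/(F p q) !fF -EFinM -mulrBr; congr EFin.
apply: (@additive_ge0_linear _ f); rewrite ?subr_ge0 ?(ltW c0) ?(ltW pq)//.
  move=> s t s0 t0; apply: EFin_inj; rewrite EFinD !fineK//.
  rewrite -(shift 0 t s) add0r [t + s]addrC -measureU//; last first.
    rewrite -subset0 => h [[_ /andP[_ h1]] [_ /andP[h2 _]]].
    by have := lt_le_trans h1 h2; rewrite ltxx.
  rewrite -setIUr; congr (Lambda (B `&` _)); apply/seteqP; split => h.
    move=> /andP[h1 h2]; have [hs|hs] := ltP (intercept i 0 h) s.
      by left; rewrite /slab /= h1 hs.
    by right; rewrite /slab /= hs h2.
  move=> [] /andP[h1 h2]; rewrite /slab /=.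
    by rewrite h1 (lt_le_trans h2)// lerDl.
  by rewrite h2 (le_trans s0).
by move=> t t0; rewrite fine_ge0.
Qed.

(* The transversal hyperplanes hitting an open set [O] are those with
   [- r < intercept i y h < r] for some rational ball [ball y r] inside [O], and
   [intercept i 0 h - intercept i y h] depends on the direction of [h] only. *)
Lemma slab_sets_gen i (A : set H) : measurable A ->
  <<s slab_sets i >> (A `&` transversal i).
Proof.
have slab_setsT (B : set H) : measurable B -> line_invariant i B -> <<s slab_sets i >> B.
  move=> mB iB.
  rewrite [X in <<s _ >> X](_ : _ = \bigcup_n (B `&` slab i (- n%:R) n%:R)).
    apply: sigma_algebra_bigcup => n; apply: sub_sigma_algebra.
    by exists B, (- n%:R), n%:R.
  rewrite -setI_bigcupr; apply/seteqP; split => [h Bh|h []//]; split => //.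
  exists (Num.Def.trunc `|intercept i 0 h|).+1 => //=.
  have := truncnS_gt `|intercept i 0 h|; rewrite ltr_norml => /andP[h1 h2].
  by rewrite /slab /= h2 (ltW h1).
have sN : <<s slab_sets i >> (@transversal R l i).
  by apply: slab_setsT; [exact: measurable_transversal|exact: transversal_invariant].
move=> mA.
pose G : set_system H := [set A | <<s slab_sets i >> (A `&` transversal i)].
suff : G A by [].
pose HG := g_sigma_algebraType (slab_sets i).
apply: hyperplane_gen mA.
  split; rewrite /G /=.
  - by rewrite set0I; exact: sigma_algebra0.
  - move=> B mB.
    have -> : (setT `\` B) `&` transversal i = transversal i `\` (B `&` transversal i).
      by rewrite setTD setDIr setDv setU0 setDE setIC.
    exact: (@measurableD _ HG).
  - by move=> F mF; rewrite setI_bigcupl; exact: sigma_algebra_bigcup.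
move=> j; rewrite /G /=.
pose ctr (k : 'rV[rat]_l.+1 * nat) : E := map_mx ratr k.1.
pose D (k : 'rV[rat]_l.+1 * nat) : set H :=
  [set h | [/\ rball R true k `<=` rball R true j, transversal i h &
    - k.2.+1%:R^-1 < intercept i (ctr k) h < k.2.+1%:R^-1]].
have -> : [set h : H | hyperplane_set h `&` rball R true j !=set0] `&` transversal i =
    \bigcup_k D k.
  apply/seteqP; split => h.
    move=> [[x [hx jx]] th].
    have /nbhs_ballP[e /= e0 xe] : nbhs x (rball R true j).
      by apply: open_nbhs_nbhs; split => //; exact: rball_open.
    have /ltr_add_invr[n] : 0 < e / 2 by rewrite divr_gt0.
    rewrite add0r; have n0 : 0 < n.+1%:R^-1 :> R by rewrite invr_gt0.
    set r : R := n.+1%:R^-1 in n0 * => re.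
    (* Points within [r] of [x] from which [h] is reached along ['e_i] within distance [r]. A
       rational centre in [U], taken with the radius [r] instead of its own, gives a ball inside
       [ball x e]. *)
    pose U := ball x r `&` (fun y => intercept i y h) @^-1` `]- r, r[%classic.
    have oU : open U.
      apply: openI; first exact: ball_open.
      apply: open_comp; last exact: itv_open.
      move=> y _.
      apply: (@cvgM _ _ (nbhs y) _ (fun y => offset h - dot (normal h) y)
        (fun=> (normal h 0 i)^-1)); last exact: cvg_cst.
      apply: (@cvgB _ _ _ (nbhs y) _ (fun=> offset h) (dot (normal h))).
        exact: cvg_cst.
      exact: dot_continuous.
    have Ux : U x.
      split; first exact: ballxx.
      have x0 : 0 = intercept i x h by apply/interceptP; rewrite // scale0r addr0.
      by rewrite /= in_itv/= -x0 oppr_lt0 n0.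
    have [k xk kU] := rball_base_open oU Ux.
    have [xr] : U (ctr k) by apply: kU; apply: ballxx; rewrite invr_gt0.
    rewrite /= in_itv/= => kr.
    exists (k.1, n) => //; split => //= y ky; apply: xe.
    have := ball_triangle xr ky; apply: le_ball; rewrite -/r; lra.
  move=> [k _ [kj th /andP[k1 k2]]]; split => //.
  exists (ctr k + intercept i (ctr k) h *: 'e_i); split; first exact/interceptP.
  apply: kj; split; first by rewrite invr_gt0.
  move=> a b; rewrite /ball /= (ord1 a) !mxE opprD addNKr normrN normrM eqxx /=.
  apply: (@le_lt_trans _ _ `|intercept i (ctr k) h|).
    by rewrite ler_piMr//; case: (b == i); rewrite ?normr1 ?normr0.
  by rewrite ltr_norml k1.
apply: (@countable_bigcupT_measurable _ HG) => [|k]; first exact: countableP.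
have [kj|nkj] := pselect (rball R true k `<=` rball R true j); last first.
  by rewrite [X in measurable X](_ : _ = set0)// -subset0 => h [].
(* The condition in [D k] reads [f h - r < intercept i 0 h < f h + r]. Rationals inserted on either
   side of the intercept split it into a slab condition and a condition on [f h], which is invariant
   along ['e_i]. *)
set r : R := k.2.+1%:R^-1; pose f h := intercept i 0 h - intercept i (ctr k) h.
pose B (q : rat * rat) : set H :=
  transversal i `&` f @^-1` `]ratr q.2 - r, ratr q.1 + r[%classic.
rewrite [X in measurable X](_ : _ =
    \bigcup_q (B q `&` slab i (ratr q.1) (ratr q.2))); last first.
  apply/seteqP; split => h; rewrite /D /f /B /slab /= -/r.
    move=> [_ th /andP[h1 h2]].
    have [|q1] := @rat_in_itvoo R (f h - r) (intercept i 0 h); first by rewrite /f; lra.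
    rewrite in_itv/= /f => /andP[q1l q1r].
    have [|q2] := @rat_in_itvoo R (intercept i 0 h) (f h + r); first by rewrite /f; lra.
    rewrite in_itv/= /f => /andP[q2l q2r].
    exists (q1, q2) => //=; split; last by rewrite q2l ltW.
    split => //; rewrite in_itv/=; move: q1l q1r q2l q2r.
    move: (ratr q1) (ratr q2) => p1 p2 *; apply/andP; split; lra.
  move=> [[q1 q2] _ /= [[th]]]; rewrite in_itv/=.
  move: (ratr q1) (ratr q2) => p1 p2 /andP[+ +] /andP[? ?].
  rewrite /f => ? ?; split; [exact: kj|exact: th|apply/andP; split; lra].
apply: (@countable_bigcupT_measurable _ HG) => [|q]; first exact: countableP.
apply: sub_sigma_algebra; exists (B q), (ratr q.1), (ratr q.2); split => //.
  apply: measurableI; first exact: measurable_transversal.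
  rewrite -[X in measurable X]setTI; apply: measurable_funB => //;
    exact: measurable_intercept.
move=> t h [th fh]; have [t0 e0] := transversal_htranslate t 0 th.
have [_ e1] := transversal_htranslate t (ctr k) th.
split => //; move: fh; rewrite /f /= e0 e1.
by rewrite (_ : _ + t - _ = intercept i 0 h - intercept i (ctr k) h)//; ring.
Qed.

(** Both sides are measures in [A]. On the hyperplanes transversal to one axis they agree on the
    pi-system [slab_sets], which generates there and contains an exhausting sequence of finite
    measure; every hyperplane is transversal to some axis. *)
Lemma driving_scaling c (A : set H) : 0 < c -> measurable A ->
  Lambda (hdilate c @^-1` A) = (c^-1%:E * Lambda A)%E.
Proof.
move=> c0 mA; have c0' : c != 0 by rewrite gt_eqF.
have mh : measurable_fun setT (@hdilate R l c) by exact: measurable_hdilate.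
have c1 : 0 <= c^-1 by rewrite invr_ge0 ltW.
pose nu0 := (pushforward Lambda (hdilate c) : {measure set H -> \bar R}).
pose nu : {measure set H -> \bar R} := nu0 mh.
pose ka : {measure set H -> \bar R} := mscale (NngNum c1) Lambda.
suff : nu A = ka A by [].
(* [inord] extends the finite cover indexed by the axes to a sequence. *)
pose t n : set H := @transversal R l (inord n).
have mt n : measurable (t n) by exact: measurable_transversal.
apply: (@g_sigma_algebra_measure_unique_cover _ R H measurable _ t) => //.
- rewrite -subTset => h _; have [i ti] := transversal_cover h.
  by exists i => //; rewrite /t inord_val.
- move=> n B; rewrite sigma_algebra_id; last exact: sigma_algebra_measurable.
  move=> mB; pose i : 'I_l.+1 := inord n.
  rewrite setIC -[nu _]/(nu (B `&` transversal i)) -[ka _]/(ka (B `&` transversal i)).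
  have mm (m : {measure set H -> \bar R}) : m (B `&` transversal i) =
      mrestr m (mt n) (B `&` transversal i) by rewrite /mrestr -setIA setIid.
  rewrite (mm nu) (mm ka).
  apply: (@g_sigma_algebra_measure_unique _ _ _ (slab_sets i)
    (@slab_sets_measurable i) (fun k => slab i (- k%:R) k%:R)).
  + by move=> k; exists setT, (- k%:R), k%:R; rewrite setTI.
  + rewrite -subTset => h _; exists (Num.Def.trunc `|intercept i 0 h|).+1 => //=.
    have := truncnS_gt `|intercept i 0 h|; rewrite ltr_norml => /andP[h1 h2].
    by rewrite /slab /= h2 (ltW h1).
  + exact: slab_sets_setI.
  + move=> _ [C [p [q [mC iC ->]]]].
    rewrite -[LHS]/(nu (C `&` slab i p q `&` transversal i)).
    rewrite -[RHS]/(ka (C `&` slab i p q `&` transversal i)) setIAC.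
    have iCt : line_invariant i (C `&` transversal i).
      by move=> s h [Ch th]; split; [exact: iC|exact: transversal_invariant].
    have Ct : C `&` transversal i `<=` transversal i by exact: subIsetr.
    have mCt : measurable (C `&` transversal i).
      by apply: measurableI => //; exact: measurable_transversal.
    rewrite -[nu _]/(Lambda (hdilate c @^-1` (C `&` transversal i `&` slab i p q))).
    rewrite -[ka _]/(c^-1%:E * Lambda (C `&` transversal i `&` slab i p q))%E.
    have -> : p = c * (p / c) by rewrite mulrC divfK.
    have -> : q = c * (q / c) by rewrite mulrC divfK.
    rewrite hdilate_slab// driving_slab_scaling// muleA -EFinM.
    by rewrite mulVf// mul1e.
  + move=> k; rewrite -[X in (X < _)%E]/(nu (slab i (- k%:R) k%:R `&` transversal i)).
    rewrite setIC -[nu _]/(Lambda (hdilate c @^-1` (transversal i `&` slab i (- k%:R) k%:R))).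
    have -> : k%:R = c * (k%:R / c) by rewrite mulrC divfK.
    have -> : - (c * (k%:R / c)) = c * (- (k%:R / c)) by rewrite mulrN.
    rewrite hdilate_slab//; first exact: slab_finite.
    exact: transversal_invariant.
  + exact: slab_sets_gen.
- by rewrite sigma_algebra_id; [exact: mA|exact: sigma_algebra_measurable].
Qed.

End driving_scaling.

(** * Uniqueness of the law of the marks *)

Section integral_subsigma.
Context d (T : measurableType d) (R : realType).
Variables (G : set_system T) (m1 m2 : {measure set T -> \bar R}).
Hypothesis sG : sigma_algebra setT G.
Hypothesis Gm : G `<=` measurable.
Hypothesis m12 : forall A, G A -> m1 A = m2 A.

(** The extension [h] of [g] by [0] outside [D] is [G]-measurable, so both measures have the same
    image under [h], and the integral depends on this image only. *)
Lemma ge0_integral_subsigma (D : set T) (g : T -> R) : G D ->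
  (forall U, measurable U -> G (g @^-1` U)) -> (forall x, 0 <= g x) ->
  (\int[m1]_(x in D) (g x)%:E = \int[m2]_(x in D) (g x)%:E)%E.
Proof.
move=> GD Gg g0; pose TG := g_sigma_algebraType G.
have toM A : G A -> @measurable _ TG A by exact: sub_sigma_algebra.
have ofM A : @measurable _ TG A -> G A by rewrite -[in G A](sigma_algebra_id sG).
pose h := g \_ D.
have Gh U : measurable U -> G (h @^-1` U).
  move=> mU; have : measurable_fun setT (h : TG -> R).
    apply/(measurable_restrictT (T1 := TG) _ (toM _ GD)).
    move=> mD V mV; apply: (@measurableI _ TG); first exact: toM.
    by apply: toM; exact: Gg.
  by move=> /(_ (@measurableT _ TG) U mU); rewrite setTI; exact: ofM.
have h0 x : 0 <= h x by rewrite /h patchE; case: ifP.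
have mh : measurable_fun setT h by move=> _ U mU; rewrite setTI; exact/Gm/Gh.
(* The absolute value makes the integrand nonnegative on the whole line; it changes nothing as [h]
   is nonnegative. *)
have E (m : {measure set T -> \bar R}) : (\int[m]_(x in D) (g x)%:E =
    \int[pushforward m h]_y `|y%:E|)%E.
  rewrite (ge0_integral_pushforward mh)//; last exact: measurableT_comp.
  rewrite preimage_setT integral_mkcond; apply: eq_integral => x _ /=.
  by rewrite ger0_norm// /h !patchE; case: ifP.
rewrite !E; apply: eq_measure_integral => A mA _.
by rewrite /= /pushforward; apply/m12/Gh.
Qed.

End integral_subsigma.

Section marks_law_unique.
Variables (R : realType) (l : nat).
Local Notation E := 'rV[R]_l.+1.
Local Notation H := (hyperplane R l).
Local Notation marks := (marks R l).
Variable Lambda : {measure set H -> \bar R}.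

Definition word_sigma (n : nat) : set_system marks :=
  sigma_gen [set v : seq bool | (size v < n)%N] (fun v (m : marks) => m v).

Lemma word_sigma_algebra n : sigma_algebra setT (word_sigma n).
Proof. exact: smallest_sigma_algebra. Qed.

Lemma word_sigmaT n : word_sigma n setT.
Proof.
by rewrite -(setD0 setT); apply: sigma_algebraCD; exact: sigma_algebra0.
Qed.

Lemma word_sigma_bigcap n (I : finType) (F : I -> set marks) :
  (forall i, word_sigma n (F i)) -> word_sigma n (\bigcap_(i in [set: I]) F i).
Proof.
set S : set_system marks := \bigcup_(v in [set v : seq bool | (size v < n)%N])
  preimage_set_system setT (fun m : marks => m v) measurable.
move=> nF; apply: (@fin_bigcap_measurable _ (g_sigma_algebraType S)) => // i _.
exact: nF.
Qed.

Lemma word_sigmaI n : setI_closed (word_sigma n).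
Proof.
move=> A B nA nB; rewrite (_ : A `&` B =
    \bigcap_(b in [set: bool]) (if b then A else B)).
  by apply: word_sigma_bigcap => -[].
apply/seteqP; split => m; first by move=> [Am Bm] [].
by move=> AB; split; [exact: (AB true)|exact: (AB false)].
Qed.

Lemma word_sigma_mark n v (A : set (R * H)) : (size v < n)%N -> measurable A ->
  word_sigma n [set m | A (m v)].
Proof.
by move=> vn mA; apply: sub_sigma_algebra; exists v => //; exists A => //; rewrite setTI.
Qed.

Lemma word_sigma_measurable n : word_sigma n `<=` measurable.
Proof.
apply: smallest_sub; first exact: sigma_algebra_measurable.
by move=> _ [v _ [A mA <-]]; apply: measurable_path.
Qed.

Lemma word_sigma_le n k : (n <= k)%N -> word_sigma n `<=` word_sigma k.
Proof.
move=> nk; apply: smallest_sub; first exact: word_sigma_algebra.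
move=> _ [v vn [A mA <-]]; rewrite setTI; apply: word_sigma_mark => //.
exact: leq_trans nk.
Qed.

Definition mark_rect (n : nat) (A : n.-tuple bool -> set R)
    (B : n.-tuple bool -> set H) : set marks :=
  [set m | forall v : n.-tuple bool, A v (lifetime m v) /\ B v (divider m v)].

Lemma mark_rect_word_sigma n A B : (forall v, measurable (A v)) ->
  (forall v, measurable (B v)) -> word_sigma n.+1 (@mark_rect n A B).
Proof.
move=> mA mB.
rewrite (_ : mark_rect A B = \bigcap_(v in [set: n.-tuple bool])
  [set m | (A v `*` B v) (m v)]); last first.
  by apply/seteqP; split => m Hm v; [move=> _; exact: (Hm v)|exact: (Hm v I)].
apply: word_sigma_bigcap => v.
apply: word_sigma_mark; first by rewrite size_tuple.
exact: measurableX.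
Qed.

Lemma split_prob_ge0 (C : set E) (A : set R) (B : set H) :
  0 <= split_prob Lambda C A B.
Proof.
have r0 : 0 <= rate Lambda C by rewrite fine_ge0.
rewrite mulr_ge0//; last by rewrite divr_ge0// fine_ge0.
rewrite fine_ge0//; apply: integral_ge0 => x _; rewrite lee_fin.
by rewrite /exponential_pdf patchE; case: ifP => // _; rewrite mulr_ge0// expR_ge0.
Qed.

(** Induction on the length of words. Intersections of a [mark_rect] with a set of [word_sigma n]
    form a pi-system generating [word_sigma n.+1]; on them [marks_law] gives the integral of a
    [word_sigma n]-measurable function, the same for both laws. The increasing union of all
    [word_sigma n] is a pi-system generating the sigma-field of the marks. *)
Lemma marks_law_unique (W : set E) (Q1 Q2 : probability marks R) :
  marks_law Lambda W Q1 -> marks_law Lambda W Q2 ->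
  forall A, measurable A -> Q1 A = Q2 A.
Proof.
move=> law1 law2.
have Qn n : forall A, word_sigma n A -> Q1 A = Q2 A.
  elim: n => [|n IH].
    (* No word has length below [0], so the first sigma-field is trivial. *)
    pose tr : set_system marks := [set A | A = set0 \/ A = setT].
    have -> : word_sigma 0 = <<s tr >>.
      apply/seteqP; split; apply: smallest_sub; try exact: smallest_sigma_algebra.
        by move=> A [].
      move=> A [->|->]; first exact: sigma_algebra0.
      by rewrite -(setD0 setT); apply: sigma_algebraCD; exact: sigma_algebra0.
    apply: (@g_sigma_algebra_measure_unique _ _ _ tr _ (fun=> setT)).
    - by move=> A [->|->].
    - by move=> _; right.
    - by rewrite bigcup_const//; exists 0%N.
    - by move=> A B [->|->] [->|->]; rewrite ?setI0 ?set0I ?setIT; [left|left|left|right].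
    - move=> A [->|->]; first by rewrite !measure0.
      by transitivity (1%E : \bar R); [|apply/esym]; exact: probability_setT.
    - by move=> _; rewrite (le_lt_trans (probability_le1 _ _))// ltry.
  pose G : set_system marks := [set S | exists D A B, [/\ word_sigma n D,
    forall v, measurable (A v), forall v, measurable (B v) &
    S = @mark_rect n A B `&` D]].
  have mrT : @mark_rect n (fun=> setT) (fun=> setT) = setT by apply/seteqP; split.
  have GT : G setT.
    exists setT, (fun=> setT), (fun=> setT).
    by split => //; [exact: word_sigmaT|rewrite mrT setTI].
  have Gm : G `<=` measurable.
    move=> _ [D [A [B [sD mA mB ->]]]]; apply: measurableI.
      by apply: (@word_sigma_measurable n.+1); exact: mark_rect_word_sigma.
    exact: word_sigma_measurable sD.
  move=> S sS; apply: (@g_sigma_algebra_measure_unique _ _ _ G Gm (fun=> setT)).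
  - by move=> _.
  - by rewrite bigcup_const//; exists 0%N.
  - move=> _ _ [D [A [B [sD mA mB ->]]]] [D' [A' [B' [sD' mA' mB' ->]]]].
    exists (D `&` D'), (fun v => A v `&` A' v), (fun v => B v `&` B' v); split.
    + exact: word_sigmaI.
    + by move=> v; exact: measurableI.
    + by move=> v; exact: measurableI.
    + rewrite setIACA; congr (_ `&` _); apply/seteqP; split => m.
        by move=> [h h'] v; have [? ?] := h v; have [? ?] := h' v.
      by move=> h; split => v; have [[? ?] [? ?]] := h v.
  - move=> _ [D [A [B [sD mA mB ->]]]].
    have [g1 e1] := law1 n A B mA mB; have [_ e2] := law2 n A B mA mB.
    apply: (etrans (e1 D sD)); apply: etrans (esym (e2 D sD)).
    apply: (ge0_integral_subsigma (word_sigma_algebra n)) => //.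
    + exact: word_sigma_measurable.
    + by move=> m; apply: prodr_ge0 => v _; exact: split_prob_ge0.
  - by move=> _; rewrite (le_lt_trans (probability_le1 _ _))// ltry.
  move: S sS; apply: smallest_sub; first exact: smallest_sigma_algebra.
  move=> _ [v vn [C mC <-]]; rewrite setTI.
  move: vn; rewrite /= ltnS leq_eqVlt => /orP[/eqP vn|vn]; last first.
    apply: sub_sigma_algebra; exists [set m | C (m v)], (fun=> setT), (fun=> setT).
    by split => //; [exact: word_sigma_mark|rewrite mrT setTI].
  pose L := [set C : set (R * H) | <<s G >> [set m : marks | C (m v)]].
  suff : L C by [].
  move: mC; rewrite measurable_prod_measurableType; move: C; apply: smallest_sub.
    apply: (@sigma_algebra_preimageT _ _ (fun m : marks => m v)).
    exact: smallest_sigma_algebra.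
  move=> _ [A mA [B mB <-]]; apply: sub_sigma_algebra.
  (* A condition on the mark of one word of length [n] is a rectangle that leaves the other words
     free. *)
  exists setT, (fun w => if tval w == v then A else setT),
    (fun w => if tval w == v then B else setT); split.
  - exact: word_sigmaT.
  - by move=> w; case: ifP.
  - by move=> w; case: ifP.
  rewrite setIT; apply/seteqP; split => m /=.
    by move=> [Am Bm] w; case: eqP => // ->.
  have sv : size v == n by rewrite vn.
  by move=> /(_ (Tuple sv)) /=; rewrite eqxx.
move=> A mA; apply: (@g_sigma_algebra_measure_unique _ _ _
  (\bigcup_n word_sigma n) _ (fun=> setT)).
- by move=> B [n _]; exact: word_sigma_measurable.
- by move=> _; exists 0%N => //; exact: word_sigmaT.
- by rewrite bigcup_const//; exists 0%N.
- move=> B C [n _ nB] [k _ kC]; exists (maxn n k) => //.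
  apply: word_sigmaI.
    by apply: word_sigma_le nB; exact: leq_maxl.
  by apply: word_sigma_le kC; exact: leq_maxr.
- by move=> B [n _]; exact: Qn.
- by move=> _; rewrite (le_lt_trans (probability_le1 _ _))// ltry.
move: A mA; apply: sub_sigma_algebra2 => _ [v _ [C mC <-]].
exists (size v).+1 => //; rewrite setTI; exact: word_sigma_mark.
Qed.

End marks_law_unique.

(** * Scaling of the marks *)

Section exponential_scaling.
Variable R : realType.

(** The image of Lebesgue measure under division by [c], scaled by [c^-1], gives half-open intervals
    their length, hence is Lebesgue measure. *)
Lemma lebesgue_measure_dilate (c : R) (A : set R) : 0 < c -> measurable A ->
  lebesgue_measure ((fun x : R => x / c) @^-1` A) = (c%:E * lebesgue_measure A)%E.
Proof.
move=> c0 mA; have c1 : 0 <= c^-1 by rewrite invr_ge0 ltW.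
pose f : measurableTypeR R -> measurableTypeR R := fun x => x / c.
have mf : measurable_fun setT f.
  by apply: measurable_funM => //; exact: measurable_cst.
pose nu0 := (pushforward (@lebesgue_measure R) f :
  {measure set (measurableTypeR R) -> \bar R}).
pose nu : {measure set (measurableTypeR R) -> \bar R} := mscale (NngNum c1) (nu0 mf).
have -> : lebesgue_measure A = nu A; last first.
  rewrite /nu /nu0 /mscale /pushforward /= muleA -EFinM divff ?mul1e//.
  by rewrite gt_eqF.
have := @lebesgue_measure_unique R nu; apply => //.
  move=> _ [[a b] _ <-].
have fE : f @^-1` `]a, b]%classic = `]c * a, c * b]%classic.
  apply/seteqP; split => x; rewrite /f /= !in_itv/= ltr_pdivlMr// ler_pdivrMr//;
    by rewrite [a * c]mulrC [b * c]mulrC.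
have -> : nu `](a, b).1, (a, b).2]%classic =
    (c^-1%:E * lebesgue_measure (f @^-1` `]a, b]%classic))%E by [].
rewrite fE.
rewrite !lebesgue_measure_itv /= !lte_fin ltr_pM2l//.
case: ifPn => _; last by rewrite mule0.
by rewrite -!EFinB -EFinM -mulrBr mulKf// gt_eqF.
Qed.

(** Change of variables: the density of rate [c * r] at [x] is [c] times the density of rate [r] at
    [c * x]. *)
Lemma exponential_prob_scaling (c r : R) (A : set R) : 0 < c -> 0 <= r ->
  measurable A ->
  exponential_prob (c * r) A = exponential_prob r ((fun x : R => x / c) @^-1` A).
Proof.
move=> c0 r0 mA; have c1 : c != 0 by rewrite gt_eqF.
pose f : measurableTypeR R -> measurableTypeR R := fun x => x / c.
have mf : measurable_fun setT f.
  by apply: measurable_funM => //; exact: measurable_cst.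
have pdf0 x : 0 <= exponential_pdf r x.
  by rewrite /exponential_pdf patchE; case: ifP => // _; rewrite mulr_ge0// expR_ge0.
have mg : measurable_fun (A : set (measurableTypeR R)) (fun x => (exponential_pdf r (c * x))%:E).
  apply/measurable_EFinP/measurable_funTS.
  apply: (measurableT_comp (measurable_exponential_pdf r)).
  by apply: measurable_funM => //; exact: measurable_cst.
have H := ge0_integral_pushforward mf (@lebesgue_measure R) mA mg.
rewrite /exponential_prob.
have -> : (\int[lebesgue_measure]_(x in f @^-1` A) (exponential_pdf r x)%:E =
    \int[lebesgue_measure]_(x in f @^-1` A) (exponential_pdf r (c * f x))%:E)%E.
  by apply: eq_integral => x _; rewrite /f mulrCA divff// mulr1.
rewrite -[RHS]H; last by move=> x _; rewrite lee_fin.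
rewrite [RHS](eq_measure_integral (mscale (NngNum (ltW c0)) lebesgue_measure)); last first.
  move=> B mB _; exact: (lebesgue_measure_dilate c0 mB).
rewrite ge0_integral_mscale//; last by move=> x _; rewrite lee_fin.
rewrite -ge0_integralZl//=; last 2 first.
- by move=> x _; rewrite lee_fin.
- by rewrite lee_fin ltW.
apply: eq_integral => x _; rewrite -EFinM; congr EFin.
have [x0|x0] := leP 0 x.
  rewrite !exponential_pdfE// ?mulr_ge0 ?(ltW c0)//.
  by rewrite mulrA !mulNr mulrA [c * r]mulrC.
by rewrite !lt0_exponential_pdf ?mulr0// pmulr_rlt0.
Qed.

End exponential_scaling.

Section marks_scaling.
Variables (R : realType) (l : nat).
Local Notation E := 'rV[R]_l.+1.
Local Notation H := (hyperplane R l).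
Local Notation marks := (marks R l).
Variable Lambda : {measure set H -> \bar R}.
Hypothesis hLambda : driving_measure Lambda.

(** Dilating a cell by [c] multiplies its rate by [c], which divides its lifetime by [c] in law. *)
Definition mark_scale (c : R) (x : R * H) : R * H := (x.1 / c, hdilate c x.2).

Definition marks_scale (c : R) (m : marks) : marks := fun v => mark_scale c (m v).

Lemma measurable_mark_scale c : c != 0 -> measurable_fun setT (mark_scale c).
Proof.
move=> c0; apply/measurable_fun_pairP; split.
  apply: (measurable_funM (f := fst)) => //; exact: measurable_cst.
exact: measurableT_comp (measurable_hdilate c0) _.
Qed.

Lemma word_sigma_scale c n (S : set marks) : c != 0 -> word_sigma n S ->
  word_sigma n (marks_scale c @^-1` S).
Proof.
move=> c0 sS; pose G : set_system marks := [set S | word_sigma n (marks_scale c @^-1` S)].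
suff : G S by [].
move: S sS; apply: smallest_sub.
  by apply: sigma_algebra_preimageT; exact: word_sigma_algebra.
move=> _ [v vn [A mA <-]]; rewrite /G /= setTI.
apply: (@word_sigma_mark R l n v (mark_scale c @^-1` A)) => //.
by rewrite -[X in measurable X]setTI; exact: measurable_mark_scale.
Qed.

Lemma measurable_marks_scale c : c != 0 -> measurable_fun setT (marks_scale c).
Proof.
move=> c0; apply: (@measurable_paths _ _ (R * H)%type) => v.
have mv := @measurable_path (seq bool) _ (R * H)%type v.
exact: measurableT_comp (measurable_mark_scale c0) mv.
Qed.

Lemma marks_scaleVK c : c != 0 -> cancel (marks_scale c^-1) (marks_scale c).
Proof.
move=> c0 m; apply/funext => v; rewrite /marks_scale /mark_scale /=.
by rewrite hdilateVK// invrK mulfK//; case: (m v).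
Qed.

(** A dilation keeps the normal vector that labels the sides and multiplies the offset by [c]; as
    [c] is positive, the labels are not exchanged. *)
Lemma side_hdilate c b (h : H) : 0 < c -> side b (hdilate c h) = dilate c (side b h).
Proof.
move=> c0; have c0' : c != 0 by rewrite gt_eqF.
have sub (d : R) (k : H) : 0 < d -> dilate d (side b k) `<=` side b (hdilate d k).
  move=> d0 _ [x [u [r [ui kE bx]]] <-]; exists u, (d * r); split => //.
    rewrite hdilateE ?gt_eqF// dilateE ?gt_eqF// kE.
    apply/seteqP; split => z; rewrite /= dotZr.
      by move=> /(canRL (mulVKf _)) ->//; rewrite gt_eqF.
    by move=> ->; rewrite mulKf// gt_eqF.
  by rewrite dotZr; case: b bx => bx; rewrite ler_pM2l.
apply/seteqP; split; last exact: sub.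
move=> x xs; exists (c^-1 *: x); last by rewrite scalerA divff// scale1r.
by rewrite -(hdilateK c0' h); apply: sub; [rewrite invr_gt0|exists x].
Qed.

Lemma cell_marks_scale c (W : set E) m v : 0 < c ->
  cell W (marks_scale c m) v = dilate c (cell (dilate c^-1 W) m v).
Proof.
move=> c0; have c0' : c != 0 by rewrite gt_eqF.
elim: v => [|b v IH] /=; first by rewrite dilateVK.
by rewrite IH dilateI// /divider /= side_hdilate.
Qed.

Lemma birth_marks_scale c m v : birth (marks_scale c m) v = birth m v / c.
Proof. by elim: v => [|b v IH] /=; rewrite ?mul0r// IH -mulrDl. Qed.

Definition monic_normal (u : E) (i : 'I_l.+1) :=
  u 0 i = 1 /\ forall j : 'I_l.+1, (j < i)%N -> u 0 j = 0.

(** If [i < i'], adding the [i]-th basis vector would change [dot u] but not [dot u'], so the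
    leading indices agree. Then [x] is moved along this basis vector onto the hyperplane, where both
    equations hold. *)
Lemma monic_normal_unique (u u' : E) i i' r r' : monic_normal u i ->
  monic_normal u' i' -> [set y | dot u y = r] = [set y | dot u' y = r'] ->
  forall x, dot u x - r = dot u' x - r'.
Proof.
have ltF (v v' : E) k k' s s' : monic_normal v k -> monic_normal v' k' ->
    [set y | dot v y = s] = [set y | dot v' y = s'] -> (k < k')%N -> False.
  move=> [v1 _] [_ v'0] hE kk'.
  have h0 : [set y | dot v y = s] (s *: delta_mx 0 k).
    by rewrite /= dotZr dot_delta v1 mulr1.
  have : [set y | dot v y = s] (s *: delta_mx 0 k + delta_mx 0 k).
    by move: h0; rewrite hE /= dotDr => ->; rewrite dot_delta v'0// addr0.
  by rewrite /= dotDr h0 dot_delta v1; lra.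
move=> ui u'i hE x.
have ii' : i = i'.
  apply: val_inj; apply/eqP; rewrite eqn_leq leqNgt [(i' <= i)%N]leqNgt.
  by apply/andP; split; apply/negP; [exact: ltF u'i ui (esym hE)|exact: ltF ui u'i hE].
subst i'; have [u1 _] := ui; have [u'1 _] := u'i.
have : [set y | dot u y = r] (x + (r - dot u x) *: delta_mx 0 i).
  by rewrite /= dotDr dotZr dot_delta u1; lra.
by rewrite hE /= dotDr dotZr dot_delta u'1; lra.
Qed.

(** Serves to make cells compact. By uniqueness of the monic equation of [h], a side is a single
    closed half-space. *)
Lemma side_closed b (h : H) : closed (side b h).
Proof.
have [[u [r [[i ui] hE]]]|nu] := pselect (exists (u : E) (r : R),
  (exists i, monic_normal u i) /\ hyperplane_set h = [set y | dot u y = r]); last first.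
  rewrite [X in closed X](_ : _ = set0); first exact: closed0.
  by rewrite -subset0 => x [u [r [ui hE _]]]; apply: nu; exists u, r; split.
pose J : set R := if b then [set s | r <= s] else [set s | s <= r].
rewrite (_ : side b h = dot u @^-1` J).
  apply: preimage_closed; first by move=> x _; exact: dot_continuous.
  by rewrite /J; case: (b); [exact: closed_ge|exact: closed_le].
apply/seteqP; split => x.
  move=> [u' [r' [[i' u'i] hE' bx]]].
  have ux := monic_normal_unique u'i ui (etrans (esym hE') hE) x.
  by rewrite /J /=; clear J; case: b bx => /=; lra.
by move=> Jx; exists u, r; split; [exists i|exact: hE|move: Jx; rewrite /J; clear J; case: b].
Qed.

Lemma hitting_dilate c (C : set E) : c != 0 ->
  hitting (dilate c C) = hdilate c^-1 @^-1` hitting C.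
Proof.
move=> c0; apply/seteqP; split => h /=; rewrite /hitting /=.
  by move=> hC; apply/hdilate_hit; rewrite ?invr_eq0// invrK.
by move/hdilate_hit; rewrite invr_eq0 invrK; apply.
Qed.

Lemma hitting_finite (C : set E) : compact C -> (Lambda (hitting C) < +oo)%E.
Proof.
move=> cC; have [_ _ _ fin _] := hLambda; have [W CW] := compact_window cC.
apply: le_lt_trans (fin W); apply: le_measure.
- by rewrite inE; exact: measurable_hitting.
- by rewrite inE; exact/measurable_hitting/polytope_compact/window_polytope.
by move=> h [x [hx Cx]]; exists x; split => //; exact: CW.
Qed.

(** The factor [c] from the homogeneity of [Lambda] rescales the exponential law of the lifetime and
    cancels in the normalised law of the divider. *)
Lemma split_prob_dilate c (C : set E) (A : set R) (B : set H) : 0 < c ->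
  compact C -> measurable A -> measurable B ->
  split_prob Lambda (dilate c C) A B =
  split_prob Lambda C ((fun x => x / c) @^-1` A) (hdilate c @^-1` B).
Proof.
move=> c0 cC mA mB; have c0' : c != 0 by rewrite gt_eqF.
have cV : 0 < c^-1 by rewrite invr_gt0.
have mC := measurable_hitting cC.
have mhB : measurable (hdilate c @^-1` B).
  by rewrite -[X in measurable X]setTI; exact: measurable_hdilate.
have S (A' : set H) : measurable A' -> A' `<=` hitting C ->
    fine (Lambda (hdilate c^-1 @^-1` A')) = c * fine (Lambda A').
  move=> mA' A'C; rewrite driving_scaling// invrK fineM// ge0_fin_numE//.
  by apply: le_lt_trans (hitting_finite cC); apply: le_measure; rewrite ?inE.
have rE : rate Lambda (dilate c C) = c * rate Lambda C.
  by rewrite /rate hitting_dilate// S.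
rewrite /split_prob rE exponential_prob_scaling//; last by rewrite fine_ge0.
congr (_ * _).
have -> : B `&` hitting (dilate c C) =
    hdilate c^-1 @^-1` ((hdilate c @^-1` B) `&` hitting C).
  rewrite hitting_dilate// preimage_setI -comp_preimage.
  rewrite (_ : hdilate c \o hdilate c^-1 = id)//.
  by apply/funext => h /=; rewrite hdilateVK.
rewrite S//; last exact: measurableI.
by rewrite invfM mulrACA divff// mul1r.
Qed.

Lemma cell_compact (W : set E) m v : compact W -> compact (cell W m v).
Proof.
move=> cW; elim: v => //= b v IH; apply: compact_closedI => //; exact: side_closed.
Qed.

Lemma marks_law_scale c (W : set E) (Q : probability marks R) (f : {mfun marks >-> marks}) :
  0 < c -> compact W -> f = marks_scale c :> (marks -> marks) ->
  marks_law Lambda (dilate c^-1 W) Q -> marks_law Lambda W (distribution Q f).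
Proof.
move=> c0 cW fE lawQ n A B mA mB; have c0' : c != 0 by rewrite gt_eqF.
pose A' v := (fun x : R => x / c) @^-1` A v.
pose B' v := hdilate c @^-1` B v.
have mA' v : measurable (A' v).
  rewrite -[X in measurable X]setTI; apply: measurable_funM => //; exact: measurable_cst.
have mB' v : measurable (B' v).
  by rewrite -[X in measurable X]setTI; exact: measurable_hdilate.
have [g1 g2] := lawQ n A' B' mA' mB'.
pose g W A B (m : marks) :=
  \prod_(v : n.-tuple bool) split_prob Lambda (cell W m v) (A v) (B v).
rewrite -/(g W A B); rewrite -/(g _ A' B') in g1 g2.
have gE m : g W A B (marks_scale c m) = g (dilate c^-1 W) A' B' m.
  apply: eq_bigr => v _; rewrite cell_marks_scale// split_prob_dilate//.
  by apply: cell_compact; exact: dilate_compact.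
(* Measurability is carried over from the window [W / c] by the inverse scaling of the marks. *)
have gm U : measurable U -> word_sigma n (g W A B @^-1` U).
  move=> mU; have c1 : c^-1 != 0 by rewrite invr_eq0.
  have := word_sigma_scale c1 (g1 U mU); rewrite (_ : _ @^-1` _ = g W A B @^-1` U)//.
  by apply/seteqP; split => m /=; rewrite -gE marks_scaleVK.
split => // D sD; have mD := word_sigma_measurable sD.
rewrite ge0_integral_pushforward//; last 2 first.
- apply/measurable_EFinP => _ U mU; apply: measurableI => //.
  by apply: (@word_sigma_measurable _ _ n); exact: gm.
- by move=> m _; rewrite lee_fin prodr_ge0// => v _; exact: split_prob_ge0.
rewrite fE; have := g2 _ (word_sigma_scale c0' sD) => {}g2.
rewrite -[LHS]/(Q (f @^-1` (mark_rect A B `&` D))) fE preimage_setI.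
rewrite (_ : _ @^-1` mark_rect A B = [set m : marks | forall v : n.-tuple bool,
   A' v (lifetime m v) /\ B' v (divider m v)])// g2.
by apply: eq_integral => m _ /=; rewrite gE.
Qed.

End marks_scaling.

(** * Scaling and stationarity of the STIT process *)

Definition mfun_pack d d' (S : measurableType d) (T : measurableType d')
    (f : S -> T) (mf : measurable_fun setT f) : {mfun S >-> T} :=
  HB.pack f (isMeasurableFun.Build _ _ _ _ _ mf).

Lemma ae_preimage (R : realFieldType) d d' (S : measurableType d)
    (T : measurableType d') (mu : {measure set S -> \bar R})
    (nu : {measure set T -> \bar R}) (f : S -> T) (p : set T) :
  measurable_fun setT f ->
  (forall A, measurable A -> nu A = mu (f @^-1` A)) ->
  {ae nu, forall x, p x} -> {ae mu, forall x, p (f x)}.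
Proof.
move=> mf nuE [N [mN N0 pN]]; exists (f @^-1` N); split.
- by rewrite -[X in measurable X]setTI; exact: mf.
- by rewrite -nuE.
- by move=> x /pN.
Qed.

Lemma ae_eq_measure (R : realFieldType) d (T : measurableType d)
    (mu : {measure set T -> \bar R}) (A B : set T) :
  measurable A -> measurable B -> {ae mu, forall x, A x <-> B x} -> mu A = mu B.
Proof.
move=> mA mB [N [mN N0 AB]].
rewrite -(measureU0 mA mN N0) -(measureU0 mB mN N0); congr (mu _).
apply/seteqP; split => x [hx|hx]; try by right.
  have [Nx|Nx] := pselect (N x); first by right.
  by left; have /contrapT[] : ~ ~ (A x <-> B x) by [move/AB]; tauto.
have [Nx|Nx] := pselect (N x); first by right.
by left; have /contrapT[] : ~ ~ (A x <-> B x) by [move/AB]; tauto.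
Qed.

Section stit_scaling.
Variables (R : realType) (l : nat).
Local Notation E := 'rV[R]_l.+1.
Local Notation H := (hyperplane R l).
Local Notation marks := (marks R l).
Variable Lambda : {measure set H -> \bar R}.
Hypothesis hLambda : driving_measure Lambda.

Definition alive (W : set E) (m : marks) (t : R) : set (set E) :=
  [set cell W m v | v in [set v | birth m v <= t < birth m v + lifetime m v]].

Lemma alive_marks_scale c (W : set E) m t : 0 < c ->
  alive W (marks_scale c m) t = [set dilate c C | C in alive (dilate c^-1 W) m (c * t)].
Proof.
move=> c0; have aE v : (birth (marks_scale c m) v <= t <
    birth (marks_scale c m) v + lifetime (marks_scale c m) v) =
    (birth m v <= c * t < birth m v + lifetime m v).
  rewrite birth_marks_scale {2}/lifetime /= -mulrDl.
  by rewrite ler_pdivrMr// ltr_pdivlMr// mulrC.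
apply/seteqP; split => [_ [v /= va <-]|_ [_ [v /= va <-] <-]].
  exists (cell (dilate c^-1 W) m v); first by exists v; rewrite //= -aE.
  by rewrite cell_marks_scale.
by exists v; rewrite /= ?aE// cell_marks_scale.
Qed.

Variables (d : measure_display) (Omega : measurableType d) (P : probability Omega R).
Variable Y : {posnum R} -> Omega -> tessellation R l.
Hypothesis hY : stit_process Lambda P Y.

Definition tests (L : seq ({posnum R} * set (set E))) : set Omega :=
  [set w | forall p, p \in L -> cell_hit p.2 (cells (Y p.1 w))].

(** Tests inside [W] see only the restriction of [Y] to [W], whose law is that of a function of the
    marks. *)
Lemma stit_marks (W : window R l) : exists Q : probability marks R,
  marks_law Lambda W Q /\
  forall L, (forall p, p \in L -> local_test W p.2) ->
  exists S, [/\ measurable S, P (tests L) = Q S &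
    {ae Q, forall m, S m <->
      forall p, p \in L -> cell_hit p.2 (alive W m p.1%:num)}].
Proof.
have [mY _ /(_ W)[X [X0 XY [mX [Q [X' [lawQ mX' aeX' PQ]]]]]]] := hY.
exists Q; split => // L LW.
(* The event is stated through [X'], where it is measurable; it is known to agree with the event on
   [alive] almost everywhere. *)
exists [set m | forall p, p \in L -> cell_hit p.2 (cells (X' (p.1%:num)%:nng m))].
(* Used both for [X'] and for the coordinate process on path space. *)
have mtests d' (T : measurableType d') (Z : {nonneg R} -> T -> window_tess W) :
    (forall t, measurable_fun setT (Z t)) ->
    measurable [set m | forall p, p \in L -> cell_hit p.2 (cells (Z (p.1%:num)%:nng m))].
  move=> mZ; elim: L LW => [|q L IH] LW.
    by rewrite [X in measurable X](_ : _ = setT)//; apply/seteqP; split.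
  rewrite [X in measurable X](_ : _ =
    Z (q.1%:num)%:nng @^-1` [set T : window_tess W | cell_hit q.2 (cells T)] `&`
    [set m | forall p, p \in L -> cell_hit p.2 (cells (Z (p.1%:num)%:nng m))]).
    apply: measurableI.
      rewrite -[X in measurable X]setTI; apply: mZ => //.
      by apply: measurable_cell_hit_window; apply: LW; exact: mem_head.
    by apply: IH => p pL; apply: LW; rewrite inE pL orbT.
  apply/seteqP; split => x.
    move=> xL; split; first by apply: (xL q); exact: mem_head.
    by move=> p pL; apply: xL; rewrite inE pL orbT.
  by move=> [xq xL] p; rewrite inE => /orP[/eqP ->//|]; exact: xL.
have mS := mtests _ (paths {nonneg R} (window_tess W)) (fun t x => x t)
  (@measurable_path _ _ _).
split; first exact: mtests.
- have <- := PQ _ mS; congr (P _); apply/seteqP; split => w wL p pL.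
    rewrite /trajectory XY; apply/cell_hit_restrict; [|exact: LW|exact: wL].
    by have [] := tess_cells (Y p.1 w).
  have := wL p pL; rewrite /trajectory XY => /cell_hit_restrict; apply; last exact: LW.
  by have [] := tess_cells (Y p.1 w).
- apply: filterS aeX' => m mE; split => mL p pL.
    by have := mL p pL; rewrite mE.
  by rewrite mE; exact: mL.
Qed.

(** One window [W] contains the supports of all tests. Scaling by [c] carries the marks law of
    [W / c] to that of [W], and the cells alive at time [c * t] in [W / c] to those alive at time
    [t] in [W]. *)
Lemma stit_scaling c (c0 : 0 < c) (L : seq ({posnum R} * set (set E))) :
  (forall p, p \in L -> exists2 K : set E, compact K & local_test K p.2) ->
  P (tests L) =
  P (tests [seq (PosNum (mulr_gt0 c0 (gt0 p.1)), vdilate c p.2) | p <- L]).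
Proof.
move=> LK; set L' := map _ _; have c0' : c != 0 by rewrite gt_eqF.
have [K cK KL] : exists2 K : set E, compact K & forall p, p \in L -> local_test K p.2.
  elim: L LK {L'} => [|q L IH] LK; first by exists set0 => //; exact: compact0.
  have [|K cK KL] := IH; first by move=> p pL; apply: LK; rewrite inE pL orbT.
  have [K' cK' qK'] := LK q (mem_head _ _).
  exists (K `|` K'); first exact: compactU.
  move=> p; rewrite inE => /orP[/eqP ->|/KL].
    by apply: local_testS qK'; exact: subsetUr.
  by apply: local_testS; exact: subsetUl.
have [W KW] := compact_window cK.
have LW p : p \in L -> local_test W p.2 by move=> /KL; exact: local_testS.
have cV : c^-1 != 0 by rewrite invr_eq0.
pose Wc := Window (dilate_polytope cV (window_polytope W)).
have [Q [lawQ /(_ L LW)[S [mS -> aeS]]]] := stit_marks W.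
have [Q' [lawQ']] := stit_marks Wc.
move=> /(_ L')[_ /mapP[p pL ->]|S' [mS' -> aeS']].
  by apply: local_test_dilate => //; exact: LW.
have mf := @measurable_marks_scale R l c c0'.
have QQ' A : measurable A -> Q A = Q' (marks_scale c @^-1` A).
  move=> mA; apply: (marks_law_unique lawQ (Q2 := distribution Q' (mfun_pack mf))) => //.
  apply: (marks_law_scale hLambda c0) => //.
  exact/polytope_compact/window_polytope.
apply: etrans (QQ' S mS) _; apply: ae_eq_measure => //.
  by rewrite -[X in measurable X]setTI; exact: measurable_marks_scale.
have hE V t m : cell_hit V (alive W (marks_scale c m) t) <->
    cell_hit (vdilate c V) (alive Wc m (c * t)).
  rewrite alive_marks_scale//; split => [[_ [C aC <-] VC]|[C aC VC]].
    by exists C.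
  by exists (dilate c C) => //; exists C.
apply: filterS2 (ae_preimage mf QQ' aeS) aeS' => m /= -> ->.
split => [mL _ /mapP[p pL ->]|mL p pL]; first by apply/hE; exact: mL.
apply/hE; apply: (mL (PosNum (mulr_gt0 c0 (gt0 p.1)), vdilate c p.2)).
by apply/mapP; exists p.
Qed.

End stit_scaling.

(** * Transformed Markov processes, laws on path space, and the stationarity of [Z] *)

Lemma sub_sigma_gen (I J Omega : Type) d d' (T : measurableType d)
    (T' : measurableType d') (D : set I) (D' : set J) (X : I -> Omega -> T)
    (X' : J -> Omega -> T') :
  (forall i, D i -> exists2 j, D' j &
    exists2 h : T' -> T, measurable_fun setT h & X i = h \o X' j) ->
  sigma_gen D X `<=` sigma_gen D' X'.
Proof.
move=> XX'; apply: smallest_sub; first exact: smallest_sigma_algebra.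
move=> _ [i Di [A mA <-]]; have [j Dj [h mh ->]] := XX' i Di.
apply: sub_sigma_algebra; exists j => //; exists (h @^-1` A); last by rewrite setTI.
by rewrite -[X in measurable X]setTI; exact: mh.
Qed.

(** As [h] has a measurable left inverse [k] and the time change maps the past of [s] onto the past
    of [phi s], the past sigma-fields coincide, and the transition function is composed with
    [k s]. *)
Lemma markov_process_transform (R : realType) d (Omega : measurableType d)
    (P : probability Omega R) d' (T : measurableType d')
    di (I : porderType di) dj (J : porderType dj) (X : I -> Omega -> T)
    (phi : J -> I) (h k : J -> T -> T) :
  (forall s t, (s <= t)%O -> (phi s <= phi t)%O) ->
  (forall s i, (i <= phi s)%O -> exists2 u, (u <= s)%O & phi u = i) ->
  (forall j, measurable_fun setT (h j)) -> (forall j, measurable_fun setT (k j)) ->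
  (forall j, cancel (h j) (k j)) ->
  markov_process P X -> markov_process P (fun j => h j \o X (phi j)).
Proof.
move=> phi_le phi_surj mh mk hK mX s t A st mA.
have [|g mg [g1 g2]] := mX (phi s) (phi t) (h t @^-1` A) (phi_le _ _ st).
  by rewrite -[X in measurable X]setTI; exact: mh.
pose Z j := h j \o X (phi j).
have gZ : (g \o k s) \o Z s = g \o X (phi s).
  by apply/funext => w; rewrite /Z /= hK.
exists (g \o k s); first exact: measurableT_comp.
rewrite -/(Z s) gZ; split.
  move=> U mU; apply: sub_sigma_gen (g1 U mU) => i /= /phi_surj[u us <-].
  by exists u => //; exists (k u) => //; apply/funext => w; rewrite /Z /= hK.
move=> B sB; apply: g2; apply: sub_sigma_gen sB => u us.
by exists (phi u); [exact: phi_le|exists (h u)].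
Qed.

Lemma powR_ln_surj (R : realType) (a v : R) : 1 < a -> 0 < v ->
  a `^ (ln v / ln a) = v.
Proof.
move=> a1 v0; have a0 : 0 < a by rewrite (lt_trans ltr01).
by rewrite /powR gt_eqF// divfK ?lnK// gt_eqF// ln_gt0.
Qed.

Lemma vdilate_comp (R : realType) (l : nat) (c e : R) (V : set (set 'rV[R]_l.+1)) :
  vdilate c (vdilate e V) = vdilate (e * c) V.
Proof.
apply/funext => C; rewrite /vdilate /= /dilate image_comp; congr (V (_ @` _)).
by apply/funext => x /=; rewrite scalerA.
Qed.

(** Concatenating lists of tests shows that these events form a pi-system; it generates the product
    sigma-field by [tessellation_gen]. *)
Lemma tessellation_paths_law (R : realType) (l : nat) (I : eqType)
    (P1 P2 : probability (paths I (tessellation R l)) R) :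
  (forall L : seq (I * _), let S := [set x : paths I (tessellation R l) |
      forall p, p \in L -> cell_hit (rtest R p.2) (cells (x p.1))] in P1 S = P2 S) ->
  forall A, measurable A -> P1 A = P2 A.
Proof.
move=> P12.
pose S (L : seq (I * (('rV[rat]_l.+1 * nat) * seq (bool * ('rV[rat]_l.+1 * nat))))) :
  set (paths I (tessellation R l)) :=
  [set x | forall p, p \in L -> cell_hit (rtest R p.2) (cells (x p.1))].
pose G := range S.
have S0 : S [::] = setT by apply/seteqP; split.
have Scat L L' : S (L ++ L') = S L `&` S L'.
  apply/seteqP; split => x.
    by move=> xL; split => p pL; apply: xL; rewrite mem_cat pL ?orbT.
  by move=> [xL xL'] p; rewrite mem_cat => /orP[]; [exact: xL|exact: xL'].
have S1 t i : S [:: (t, i)] =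
    (fun x : paths I (tessellation R l) => x t) @^-1`
      [set T | cell_hit (rtest R i) (cells T)].
  apply/seteqP; split => x; first by move/(_ _ (mem_head _ _)).
  by move=> xi p; rewrite inE => /eqP ->.
have mS L : measurable (S L).
  elim: L => [|[t i] L IH]; first by rewrite S0.
  rewrite -cat1s Scat; apply: measurableI => //; rewrite S1.
  rewrite -[X in measurable X]setTI; apply: measurable_path => //.
  have [K _ /measurable_cell_hit] := rtest_local R i; exact.
move=> A mA; apply: (@g_sigma_algebra_measure_unique _ _ _ G _ (fun=> setT)).
- by move=> _ [L _ <-].
- by move=> _; exists [::].
- by rewrite bigcup_const//; exists 0%N.
- by move=> _ _ [L _ <-] [L' _ <-]; exists (L ++ L').
- by move=> _ [L _ <-]; exact: P12.
- by move=> _; rewrite (le_lt_trans (probability_le1 _ _))// ltry.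
move: A mA; apply: smallest_sub; first exact: smallest_sigma_algebra.
move=> _ [t _ [B mB <-]]; rewrite setTI.
pose F : set_system (tessellation R l) :=
  [set B | <<s G >> ((fun x : paths I (tessellation R l) => x t) @^-1` B)].
suff : F B by [].
apply: tessellation_gen mB.
  by apply: sigma_algebra_preimageT; exact: smallest_sigma_algebra.
by move=> i; rewrite /F /= -S1; apply: sub_sigma_algebra; exists [:: (t, i)].
Qed.

Theorem theorem1p1 (R : realType) (l : nat)
  (Lambda : {measure set (hyperplane R l) -> \bar R})
  (hLambda : driving_measure Lambda)
  (d : measure_display) (Omega : measurableType d) (P : probability Omega R)
  (Y : {posnum R} -> Omega -> tessellation R l)
  (hY : stit_process Lambda P Y)
  (a : R) (ha : 1 < a) :
  let a_pow_gt0 (s : R) : 0 < a `^ s := powR_gt0 s (lt_trans ltr01 ha) in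
  let Z (s : R) (w : Omega) : tessellation R l :=
    tdilate (lt0r_neq0 (a_pow_gt0 s)) (Y (PosNum (a_pow_gt0 s)) w) in
  [/\ markov_process P Z,
      (forall t : R, same_law P (trajectory Z) P (path_shift t \o trajectory Z)) &
      exists Zm : {mfun Omega >-> paths R (tessellation R l)},
        Zm = trajectory Z :> (Omega -> paths R (tessellation R l)) /\
        is_flow (distribution P Zm)
          (fun t : R => path_shift (T := tessellation R l) t)].
Proof.
move=> pa Z; have a0 : 0 < a by exact: lt_trans ltr01 ha.
have [mY markovY _] := hY.
have mZ s : measurable_fun setT (Z s).
  by apply: measurableT_comp => //; exact: measurable_tdilate.
have mtZ : measurable_fun setT (trajectory Z) by apply: measurable_paths.
have mshift t : measurable_fun setT (path_shift (T := tessellation R l) t).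
  by apply: measurable_paths => s; exact: measurable_path.
have law t : same_law P (trajectory Z) P (path_shift t \o trajectory Z).
  have mstZ : measurable_fun setT (path_shift t \o trajectory Z).
    exact: measurableT_comp.
  move=> A mA.
  apply: (tessellation_paths_law (P1 := distribution P (mfun_pack mtZ))
    (P2 := distribution P (mfun_pack mstZ))) => // L S.
  (* A test of [Z] at time [s] is the test pulled back by the dilation, applied to [Y] at time
     [a^s]. *)
  pose L1 := [seq (PosNum (pa p.1), vdilate (a `^ p.1) (rtest R (l := l) p.2)) | p <- L].
  (* Scaling by [a^t] turns the times [a^s] into [a^(s + t)] and the tests into those of [Z] at time
     [s + t]. *)
  have := stit_scaling hLambda hY (pa t) (L := L1).
  set L2 := map _ L1 => L12.
  have E1 : distribution P (mfun_pack mtZ) S = P (tests Y L1).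
    congr (P _); apply/seteqP; split => w wL.
      move=> _ /mapP[p pL ->] /=.
      by apply/(cell_hit_tdilate (lt0r_neq0 (pa p.1))); exact: wL p pL.
    move=> p pL; apply/cell_hit_tdilate.
    by apply: (wL (_, _)); apply/mapP; exists p.
  have ZE (q : {posnum R}) p w : q%:num = a `^ t * a `^ p.1 ->
      cell_hit (rtest R p.2) (cells (Z (p.1 + t) w)) <->
      cell_hit (vdilate (a `^ t) (vdilate (a `^ p.1) (rtest R p.2))) (cells (Y q w)).
    have pt : a `^ p.1 * a `^ t = a `^ (p.1 + t).
      by rewrite powRD// (gt_eqF a0) implybT.
    rewrite vdilate_comp mulrC pt => qE.
    rewrite (_ : q = PosNum (pa (p.1 + t))); last exact: val_inj.
    exact: cell_hit_tdilate.
  have E2 : distribution P (mfun_pack mstZ) S = P (tests Y L2).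
    rewrite /L2 /L1 -map_comp; congr (P _); apply/seteqP; split => w wL.
      by move=> _ /mapP[p pL ->]; apply/ZE => //; exact: wL p pL.
    by move=> p pL; have := wL _ (map_f _ pL); move/ZE; exact.
  apply: etrans E1 (etrans (L12 _) (esym E2)) => _ /mapP[p pL ->] /=.
  have [K cK Kp] := rtest_local R p.2.
  exists (dilate (a `^ p.1)^-1 K); first exact: dilate_compact.
  by apply: local_test_dilate => //; rewrite gt_eqF.
split => //.
  (* As [1 < a], the time change [a^s] is an increasing bijection from the reals to the positive
     reals, inverted by the logarithm to base [a]; the dilation by [a^s] is undone by that by
     [a^(- s)]. *)
  apply: (@markov_process_transform R d Omega P _ _ _ _ _ _ Y (fun s => PosNum (pa s))
    (fun s => tdilate (lt0r_neq0 (pa s)))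
    (fun s => tdilate (lt0r_neq0 (pa (- s))))) => //.
  - move=> s t st; rewrite -num_le /=; exact/ler_powR/st/ltW.
  - move=> s i; rewrite -num_le /= => ias.
    exists (ln i%:num / ln a); last by apply: val_inj; rewrite /= powR_ln_surj.
    rewrite ler_pdivrMr ?ln_gt0// -ln_powR ler_ln ?posrE ?powR_gt0//; exact: ias.
  - by move=> s; exact: measurable_tdilate.
  - by move=> s; exact: measurable_tdilate.
  - move=> s; apply: tdilateK; rewrite -powRD ?addNr ?powRr0//.
    by rewrite (gt_eqF a0) implybT.
exists (mfun_pack mtZ); split => // t; split => // A mA.
exact: esym (law t A mA).
Qed.
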